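(* Let $\mathbb{V}_x=\{(x,0,0):x\in\mathbb{R}\}$ denote the horizontal subgroup of the Heisenberg group $\mathbb{H}$ defined by the $x$-axis, with vertical complement $\mathbb{V}_x^\perp=\{(0,y,t):y,t\in\mathbb{R}\}$, and let $p>4$. For each $\alpha\in\left(1,\frac{p}{p-2}\right)$ there is a compact set $E_\alpha\subseteq\mathbb{V}_x^\perp$ and a continuous mapping $f\in W^{1,p}(\mathbb{H};\mathbb{R}^2)$ such that $$0<\mathcal{H}_{\mathbb{R}^3}^{\,2-p\left(1-\frac{1}{\alpha}\right)}(E_\alpha)<\infty$$ and $\dim f(a*\mathbb{V}_x)\ge\alpha$ for every $a\in E_\alpha$.
   Context: The first Heisenberg group $\mathbb{H}=\mathbb{H}^1$ is $\mathbb{R}^3$ with coordinates $(x,y,t)$ and group law $(x,y,t)*(x',y',t')=(x+x',\,y+y',\,t+t'+2(xy'-x'y))$. It is equipped with the left-invariant metric $d_{\mathbb{H}}(a,a')=\|a^{-1}*a'\|$, where $\|(x,y,t)\|=((x^2+y^2)^2+t^2)^{1/4}$, and with the $4$-dimensional Hausdorff measure $\mathcal{H}^4_{\mathbb{H}}$ of this metric (a constant multiple of Lebesgue measure). For $a\in\mathbb{V}_x^\perp$, $a*\mathbb{V}_x=\{a*v:v\in\mathbb{V}_x\}$ is the left coset. A continuous map $f\colon\mathbb{H}\to\mathbb{R}^2$ is in $W^{1,p}(\mathbb{H};\mathbb{R}^2)$ if $|f|^p$ is integrable and $f$ has an upper gradient $g\colon\mathbb{H}\to[0,\infty]$ with $g^p$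 integrable, both with respect to $\mathcal{H}^4_{\mathbb{H}}$; here an upper gradient is a Borel function $g$ such that $|f(\gamma(0))-f(\gamma(1))|\le\int_\gamma g\,ds$ for every rectifiable path $\gamma\colon[0,1]\to\mathbb{H}$ ($ds$ is arclength with respect to $d_{\mathbb{H}}$). $\mathcal{H}^s_{\mathbb{R}^3}$ denotes $s$-dimensional Hausdorff measure with respect to the Euclidean metric of $\mathbb{R}^3$, and $\dim f(a*\mathbb{V}_x)$ is Hausdorff dimension in $\mathbb{R}^2$ with the Euclidean metric. *)

(* Defs.v *)
From HB Require Import structures.
From mathcomp Require Import all_boot all_order all_algebra.
From mathcomp Require Import all_classical all_reals all_analysis.
From mathcomp Require Import measurable_realfun ring lra.

Set Implicit Arguments.
Unset Strict Implicit.
Unset Printing Implicit Defensive.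

Import Order.TTheory GRing.Theory Num.Theory.
Import numFieldNormedType.Exports.

Local Open Scope classical_set_scope.
Local Open Scope ring_scope.

Section metric.
Local Open Scope ereal_scope.
Context {R : realType} {X : Type}.
Variable d : X -> X -> R.

(* [diam set0 = -oo] *)
Definition diam (A : set X) : \bar R :=
  ereal_sup [set (d u.1 u.2)%:E | u in A `*` A].

(* The case distinction makes empty sets contribute 0 also when s = 0. *)
Definition powdiam (s : R) (A : set X) : \bar R :=
  if A == set0 then 0 else diam A `^ s.

Definition hausdorff_content (delta s : R) (A : set X) : \bar R :=
  ereal_inf [set \sum_(0 <= n <oo) powdiam s (F n) | F in
    [set F : nat -> set X | A `<=` \bigcup_n F n /\
                            forall n, diam (F n) <= delta%:E]].

Definition hausdorff_measure (s : R) (A : set X) : \bar R :=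
  ereal_sup [set hausdorff_content delta s A | delta in [set e | (0 < e)%R]].

Definition hausdorff_dim (A : set X) : \bar R :=
  ereal_inf [set s%:E | s in [set s | (0 <= s)%R /\
                                      hausdorff_measure s A = 0]].

(* Metric version of [variation], with values in a metric space. *)
Definition path_variation (a b : R) (gamma : R -> X) (s : seq R) : R :=
  let F := gamma \o nth b (a :: s) in
  (\sum_(0 <= n < size s) d (F n) (F n.+1))%R.

Definition path_length (gamma : R -> X) (a b : R) : \bar R :=
  ereal_sup [set (path_variation a b gamma s)%:E | s in itv_partition a b].

(* Reparametrization of a rectifiable path on [[0, 1]] by arclength: the point
   reached after length [s]. The value does not depend on the choice of [t],
   since [gamma] is constant where its length function is. *)
Definition arclength_param (gamma : R -> X) (s : R) : X :=
  gamma (xget 0%R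
    [set t | `[0%R, 1%R]%classic t /\ path_length gamma 0 t = s%:E]).

Definition line_integral (gamma : R -> X) (g : X -> \bar R) : \bar R :=
  \int[lebesgue_measure]_(s in `[0%R, fine (path_length gamma 0 1)])
     g (arclength_param gamma s).

End metric.

Section euclidean.
Context {R : realType}.

Definition enorm2 (u : R * R) : R := Num.sqrt (u.1 ^+ 2 + u.2 ^+ 2).

Definition edist2 (u v : R * R) : R := enorm2 (u - v).

Definition edist3 (u v : R * R * R) : R :=
  Num.sqrt ((u.1.1 - v.1.1) ^+ 2 + (u.1.2 - v.1.2) ^+ 2 + (u.2 - v.2) ^+ 2).

End euclidean.

(* The topology and the sigma-algebra used on the Heisenberg group are those of
   the product R * R * R. They are the topology of [hdist] (see [hdist_nbhsP])
   and its Borel sets (see [measurable_heisE]). *)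
Notation heis R := (R * R * R)%type.

Section heisenberg.
Context {R : realType}.

Definition hmul (a b : heis R) : heis R :=
  let: (x, y, t) := a in let: (x', y', t') := b in
  (x + x', y + y', t + t' + 2 * (x * y' - x' * y)).

Definition hinv (a : heis R) : heis R :=
  let: (x, y, t) := a in (- x, - y, - t).

Definition hnorm (a : heis R) : R :=
  let: (x, y, t) := a in ((x ^+ 2 + y ^+ 2) ^+ 2 + t ^+ 2) `^ 4^-1.

Definition hdist (a b : heis R) : R := hnorm (hmul (hinv a) b).

Definition Vx : set (heis R) := [set (x, 0, 0) | x in setT].

Definition Vx_perp : set (heis R) := [set (0, u.1, u.2) | u in setT].

Definition lcoset_Vx (a : heis R) : set (heis R) := [set hmul a v | v in Vx].

(* A Hausdorff outer measure; integrals against it only use its values on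
   measurable sets. *)
Definition heis_measure : set (heis R) -> \bar R := hausdorff_measure hdist 4.

Definition rectifiable (gamma : R -> heis R) : Prop :=
  {within `[0, 1], continuous gamma} /\
  (path_length hdist gamma 0 1 < +oo)%E.

Definition upper_gradient (f : heis R -> R * R) (g : heis R -> \bar R) : Prop :=
  [/\ forall a, (0 <= g a)%E,
      measurable_fun setT g &
      forall gamma, rectifiable gamma ->
        ((edist2 (f (gamma 0)) (f (gamma 1)))%:E
           <= line_integral hdist gamma g)%E].

Definition sobolev (p : R) (f : heis R -> R * R) : Prop :=
  heis_measure.-integrable setT (fun a => (enorm2 (f a) `^ p)%:E) /\
  exists g : heis R -> \bar R,
    upper_gradient f g /\
    heis_measure.-integrable setT (fun a => (g a `^ p)%E).

End heisenberg.

Section heis_topology.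
Context {R : realType}.

Lemma hdist_ltE (a b : heis R) (e : R) : 0 < e ->
  (hdist a b < e) =
  (((b.1.1 - a.1.1) ^+ 2 + (b.1.2 - a.1.2) ^+ 2) ^+ 2
   + (b.2 - a.2 + 2 * (a.1.2 * b.1.1 - a.1.1 * b.1.2)) ^+ 2 < e ^+ 4).
Proof.
move=> e0; set N := (X in _ = (X < _)).
have N0 : 0 <= N by rewrite addr_ge0// sqr_ge0.
have -> : hdist a b = N `^ 4^-1.
  rewrite /hdist /N; case: a b {N N0} => [[x y] t] [[x' y'] t'] /=.
  by congr (_ `^ _); ring.
have eE : e = (e ^+ 4) `^ 4^-1.
  by rewrite -powR_mulrn ?ltW// -powRrM mulfV// powRr1// ltW.
have e40 : 0 <= e ^+ 4 by rewrite exprn_ge0// ltW.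
rewrite [in LHS]eE; apply/idP/idP => [|Ne]; last by rewrite gt0_ltr_powR.
by apply: contraTT; rewrite -!leNgt => eN; rewrite ge0_ler_powR// nnegrE.
Qed.

Lemma hdist_nbhsP (a : heis R) (U : set (heis R)) :
  nbhs a U <-> exists2 e, 0 < e & [set b | hdist a b < e] `<=` U.
Proof.
split=> [/nbhs_ballP[r /= r0 rU]|[e e0 eU]].
- pose K := 1 + 2 * (`|a.1.1| + `|a.1.2|).
  have K1 : 1 <= K by rewrite /K lerDl mulr_ge0// addr_ge0.
  pose e := Num.min 1 (r / K).
  have e0 : 0 < e by rewrite lt_min ltr01 divr_gt0// (lt_le_trans _ K1).
  have e1 : e <= 1 by rewrite ge_min lexx.
  have eK : e * K <= r by rewrite -ler_pdivlMr ?ge_min ?lexx ?orbT ?(lt_le_trans _ K1).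
  have er : e <= r by rewrite (le_trans _ eK)// ler_peMr// ltW.
  exists e => // b /=; rewrite hdist_ltE// => Ne; apply: rU.
  move: Ne; set u := b.1.1 - a.1.1; set v := b.1.2 - a.1.2.
  set w := (X in _ + X ^+ 2 < _) => Ne.
  have uv : u ^+ 2 + v ^+ 2 < e ^+ 2.
    rewrite -(@ltr_pXn2r _ 2)// ?nnegrE ?addr_ge0 ?sqr_ge0//.
    by rewrite -exprM (le_lt_trans _ Ne)// lerDl sqr_ge0.
  have ue : `|u| < e.
    rewrite -(@ltr_pXn2r _ 2)// ?nnegrE// ?(ltW e0)// real_normK ?num_real//.
    by rewrite (le_lt_trans _ uv)// lerDl sqr_ge0.
  have ve : `|v| < e.
    rewrite -(@ltr_pXn2r _ 2)// ?nnegrE// ?(ltW e0)// real_normK ?num_real//.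
    by rewrite (le_lt_trans _ uv)// lerDr sqr_ge0.
  have we : `|w| < e.
    apply: (@lt_le_trans _ _ (e ^+ 2)); last by rewrite expr2 ler_piMr// ltW.
    rewrite -(@ltr_pXn2r _ 2)// ?nnegrE ?sqr_ge0// real_normK ?num_real//.
    by rewrite -exprM (le_lt_trans _ Ne)// lerDr sqr_ge0.
  have te : `|b.2 - a.2| < r.
    have -> : b.2 - a.2 = w - 2 * (a.1.2 * u) + 2 * (a.1.1 * v).
      by rewrite /w /u /v; ring.
    apply: lt_le_trans eK; rewrite /K.
    apply: (le_lt_trans (ler_normD _ _)).
    have h1 := ler_normB w (2 * (a.1.2 * u)).
    have h2 : `|2 * (a.1.2 * u)| <= 2 * (`|a.1.2| * e).
      by rewrite !normrM normr_nat ler_pM2l// ler_wpM2l// ltW.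
    have h3 : `|2 * (a.1.1 * v)| <= 2 * (`|a.1.1| * e).
      by rewrite !normrM normr_nat ler_pM2l// ler_wpM2l// ltW.
    have -> : e * (1 + 2 * (`|a.1.1| + `|a.1.2|)) =
       e + 2 * (`|a.1.2| * e) + 2 * (`|a.1.1| * e) by ring.
    by lra.
  by split; [split|]; rewrite /ball /= distrC ?(lt_le_trans ue)// ?(lt_le_trans ve).
- have hc : (fun b : heis R => ((b.1.1 - a.1.1) ^+ 2 + (b.1.2 - a.1.2) ^+ 2) ^+ 2
     + (b.2 - a.2 + 2 * (a.1.2 * b.1.1 - a.1.1 * b.1.2)) ^+ 2) b
       @[b --> a] --> (0 : R).
    have c11 : b.1.1 @[b --> a] --> a.1.1.
      by apply: (@cvg_comp _ _ _ fst fst); [exact: cvg_fst|exact: cvg_fst].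
    have c12 : b.1.2 @[b --> a] --> a.1.2.
      by apply: (@cvg_comp _ _ _ fst snd); [exact: cvg_fst|exact: cvg_snd].
    have c2 : b.2 @[b --> a] --> a.2 by exact: cvg_snd.
    rewrite [X in _ --> X](_ : _ =
     ((a.1.1 - a.1.1) ^+ 2 + (a.1.2 - a.1.2) ^+ 2) ^+ 2
       + (a.2 - a.2 + 2 * (a.1.2 * a.1.1 - a.1.1 * a.1.2)) ^+ 2); last by ring.
    have sq (g : heis R -> R) (l : R) : g b @[b --> a] --> l ->
        g b ^+ 2 @[b --> a] --> l ^+ 2 by move=> gl; rewrite !expr2; exact: cvgM.
    apply: cvgD; apply: (sq); first by apply: cvgD; apply: (sq); apply: cvgB => //; exact: cvg_cst.
    apply: cvgD; first by apply: cvgB => //; exact: cvg_cst.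
    by apply: cvgM; [exact: cvg_cst|apply: cvgB; apply: cvgM => //; exact: cvg_cst].
  have e40 : 0 < e ^+ 4 by rewrite exprn_gt0.
  have /cvgr_lt/(_ _ e40) := hc.
  by apply: filterS => b Nb; apply: eU => /=; rewrite hdist_ltE.
Qed.

Lemma open_heis_measurable (U : set (heis R)) : open U -> measurable U.
Proof.
move=> oU.
pose B (q : rat * rat * rat * nat) : set (heis R) :=
  ball (ratr q.1.1.1 : R) q.2.+1%:R^-1 `*` ball (ratr q.1.1.2 : R) q.2.+1%:R^-1
  `*` ball (ratr q.1.2 : R) q.2.+1%:R^-1.
have -> : U = \bigcup_q (if `[< B q `<=` U >] then B q else set0).
  rewrite eqEsubset; split=> [a Ua|a [q _]]; last by case: asboolP => // qU /qU.
  have /nbhs_ballP[r /= r0 rU] : nbhs a U by exact: open_nbhs_nbhs.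
  have [n nr] : exists n, n.+1%:R^-1 < r / 2.
    have /ltr_add_invr[n] : 0 < r / 2 by rewrite divr_gt0.
    by rewrite add0r; exists n.
  have n0 : 0 < n.+1%:R^-1 :> R by rewrite invr_gt0.
  have Q (x : R) : exists q : rat, `|ratr q - x| < n.+1%:R^-1.
    have /rat_in_itvoo[q] : x - n.+1%:R^-1 < x + n.+1%:R^-1.
      by rewrite ltrBlDr -addrA ltrDl addr_gt0.
    by rewrite in_itv/= => /andP[? ?]; exists q; rewrite ltr_distl; apply/andP.
  have [x xa] := Q a.1.1; have [y ya] := Q a.1.2; have [t ta] := Q a.2.
  exists (x, y, t, n) => //; case: asboolP => [_|]; first by split; [split|].
  have tri (z c q : R) : `|q - c| < n.+1%:R^-1 -> `|q - z| < n.+1%:R^-1 ->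
      ball c r z.
    move=> qc qz; rewrite /ball /= (_ : c - z = (q - z) - (q - c)); last by ring.
    apply: (le_lt_trans (ler_normB _ _)).
    by rewrite [ltRHS]splitr; apply: ltrD; apply: lt_trans nr.
  case=> b [[/= bx by_] bt]; apply: rU.
  by split; [split|]; [apply: tri xa bx|apply: tri ya by_|apply: tri ta bt].
apply: countable_bigcupT_measurable => [|q]; first exact: countableP.
case: asboolP => // _.
by apply: measurableX; [apply: measurableX|]; exact: measurable_ball.
Qed.

Lemma measurable_heisE :
  measurable = <<s (open : set (set (heis R))) >> :> set (set (heis R)).
Proof.
rewrite eqEsubset; split; last first.
  by apply: smallest_sub;
    [exact: sigma_algebra_measurable|exact: open_heis_measurable].
pose T := g_sigma_algebraType (open : set (set (heis R))).
have mT (f : heis R -> R) : continuous f -> measurable_fun setT (f : T -> R).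
  move=> /continuousP cf; apply: (measurability _ (RGenOpens.measurableE R)).
  move=> _ [_ [a [b ->] <-]]; rewrite setTI.
  by apply: sub_sigma_algebra; apply: cf; exact: interval_open.
have c12 : continuous (fun b : heis R => b.1.2).
  by move=> b; apply: (@cvg_comp _ _ _ fst snd); [exact: cvg_fst|exact: cvg_snd].
have c11 : continuous (fun b : heis R => b.1.1).
  by move=> b; apply: (@cvg_comp _ _ _ fst fst); exact: cvg_fst.
have c2 : continuous (fun b : heis R => b.2) by move=> b; exact: cvg_snd.
have mid : measurable_fun setT ((fun b => (b.1.1, b.1.2, b.2)) : T -> heis R).
  by apply: measurable_fun_pair; [apply: measurable_fun_pair|]; exact: mT.
move=> A mA; have := mid measurableT A mA; rewrite setTI.
by congr (measurable _); rewrite eqEsubset; split=> -[[]].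
Qed.

End heis_topology.

(* Main.v *)
(** The map [(x, y, t) |-> (x, y, t + 2 * x * y)] straightens the cosets
[a * V_x] into lines parallel to the x-axis, and it is locally Lipschitz from
the Heisenberg to the Euclidean metric. So it suffices to build a Euclidean
object: a compact set [E] of pairs [(y, t)] and a function of [(x, y, t)].

The set [E] is a self-similar Cantor dust with four pieces of ratio
[4 ^ (- 1 / s)], where [s = 2 - p * (1 - 1 / alpha)]; its [g]-neighbourhood has
area [O(g ^ (2 - s))]. The points of the dust and those of a Cantor set of times
[x] are both indexed by the binary digits of a parameter [r] in [0, 1[. The bump
[psi k] is 1 at the points of [times * E] whose time parameter has [k]-th digit
1, is 0 at those where this digit is 0, and is Lipschitz with constant
[O(1 / g_k)], where [g_k] is the gap between times with distinct [k]-th digits,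
about [2 ^ - k] up to a polynomial factor. The map [f] is the sum of the
[w_k * psi k], the even [k] feeding the first coordinate and the odd [k] the
second one. On every coset through [E] it takes all values of the planar dust
with weights [w_k], which are [2 ^ (- k / alpha)] up to a polynomial factor, so
that this dust has dimension [alpha]. The polynomial factors are chosen to make
the energy, the sum of the terms
[(w_k / g_k) ^ p * g_k ^ (2 - s) = (w_k / g_k ^ (1 / alpha)) ^ p], converge. *)

Require Import Defs.
From mathcomp Require Import all_boot all_order all_algebra.
From mathcomp Require Import all_classical all_reals all_analysis.
From mathcomp Require Import measurable_realfun ring lra.
From HB Require Import structures.
Set Implicit Arguments.
Unset Strict Implicit.
Import Order.TTheory GRing.Theory Num.Theory.
Import numFieldNormedType.Exports.
Local Open Scope classical_set_scope.
Local Open Scope ring_scope.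

(** With [g_k = 2 ^ - k] and [w_k = 2 ^ (- k / alpha)] exactly, every term of the energy would be 1:
    the exponent [s] is critical and some loss is forced. The times force one as well, since there
    are [2 ^ k] gaps of rank [k] and their total length must be finite. Polynomial losses are
    invisible to a lower bound on the dimension of the image, whereas [E], whose measure must be
    positive and finite, keeps exactly geometric scales.

    One family of bumps serves all cosets through [E], because over [times * E] the value of a bump
    depends on the time alone. Its support is a neighbourhood of a product, whose volume is governed
    by the area bound for [E].

    The upper gradient is the p-th root of a weighted sum of indicators of supports. It is tested by
    arclength: a Lipschitz function changes by at most its constant times the length that the path
    spends where the function is nonzero.

    The lower bounds need separated dusts. A coordinate receives every second digit, so its scales
    shrink by at least the factor [2 ^ (- 2 / s)], resp. [2 ^ (- 2 / alpha)]; this is below 1/2 for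
    exponents below 2, and [p > 4] gives [alpha < 2]. *)

Section metric_outer_measure.
Local Open Scope ereal_scope.
Context {R : realType} {T : pointedType} (d : T -> T -> R).
Variable mu : {outer_measure set T -> \bar R}.
Hypothesis dist_tri : forall x y z, (d x z <= d x y + d y z)%R.
Hypothesis separated_additive : forall (A B : set T) (e : R), (0 < e)%R ->
  (forall a b, A a -> B b -> (e <= d a b)%R) -> mu A + mu B <= mu (A `|` B).

(** Caratheodory's criterion. The sets [A n] of points at distance at least [n.+1%:R^-1] from the
    complement exhaust [X] inside [U]. Shells [D n] two ranks apart are separated, so their measures
    have a finite sum, and the part of [X] inside [U] that [A n] misses has measure tending to 0. *)
Lemma open_caratheodory (U : set T) :
  (forall x, U x -> exists2 e, (0 < e)%R & [set z | d x z < e]%R `<=` U) ->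
  mu.-caratheodory U.
Proof.
move=> oU; apply: le_caratheodory_measurable => X.
have [->|Xfin] := eqVneq (mu X) +oo; first exact: leey.
pose A (n : nat) := [set x | (X `&` U) x /\
  forall z, ~ U z -> (n.+1%:R^-1 <= d x z)%R].
pose D n := A n.+1 `\` A n.
have Asub n : A n `<=` A n.+1.
  move=> x [Ax h]; split=> // z /h; apply: le_trans.
  by rewrite lef_pV2 ?posrE ?ltr0n// ler_nat.
have AX n : A n `<=` X by move=> x [[]].
have sepAD n : mu (A n) + mu (D n.+1) <= mu (A n.+2).
  apply: le_trans (le_outer_measure mu (A n `|` D n.+1) _ _); last first.
    by move=> x [/Asub/Asub//|[]].
  pose e : R := (n.+1%:R^-1 - n.+2%:R^-1)%R.
  apply: (@separated_additive _ _ e);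
      first by rewrite subr_gt0 ltf_pV2 ?posrE ?ltr0n// ltr_nat.
  move=> a b [Aa ha] [[Ab hb] nb].
  have [z Uz zb] : exists2 z, ~ U z & (d b z < n.+2%:R^-1)%R.
    apply: contrapT => nz; apply: nb; split=> // z Uz.
    by rewrite leNgt; apply/negP => bz; apply: nz; exists z.
  move: zb (ha _ Uz) (dist_tri a b z); rewrite /e.
  by move: (_^-1)%R (_^-1)%R => u v; lra.
have mufin B : B `<=` X -> mu B \is a fin_num.
  move=> BX; rewrite ge0_fin_numE ?outer_measure_ge0//.
  by rewrite (le_lt_trans (le_outer_measure mu _ _ BX))// ltey.
(* Adding a shell advances the rank of [A] by two. Carrying two consecutive ranks sums the shells of
   both parities at once, at the price of [mu X] counted twice. *)
have sumD n : \sum_(k < n) mu (D k.+1) + (mu (A 0%N) + mu (A 1%N)) <=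
    mu (A n) + mu (A n.+1).
  elim: n => [|n ih]; first by rewrite big_ord0 add0e.
  rewrite big_ord_recr/= addeAC (le_trans (leeD2r _ ih))//.
  by rewrite addeAC addeC; apply: leeD => //; exact: sepAD.
have Dsum : \sum_(0 <= k <oo) mu (D k) < +oo.
  rewrite nneseries_recl//.
  apply: lte_add_pinfty.
    by rewrite -ge0_fin_numE ?outer_measure_ge0// mufin// => x [/AX].
  apply: (@le_lt_trans _ _ (mu X + mu X)); last first.
    by rewrite lte_add_pinfty// ltey.
  apply: lime_le; first by apply: is_cvg_nneseries => *; exact: outer_measure_ge0.
  apply: nearW => -[|n]; first by rewrite big_geq// adde_ge0// outer_measure_ge0.
  rewrite big_add1/= big_mkord.
  apply: le_trans (leeDl _ _) (le_trans (sumD n) _).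
    by rewrite adde_ge0 ?outer_measure_ge0.
  by apply: leeD; apply: le_outer_measure; exact: AX.
have tail := @nneseries_tail_cvg _ _ xpredT Dsum (fun k _ => outer_measure_ge0 mu _).
have key n : mu (X `&` U) + mu (X `&` ~` U) <=
    mu X + \sum_(n <= k <oo) mu (D k).
  apply: (@le_trans _ _ (mu (A n) + mu (X `&` ~` U) + \sum_(n <= k <oo) mu (D k))).
    rewrite addeAC; apply: leeD => //.
    apply: (@le_trans _ _ (mu (A n) + mu (\bigcup_(k in ~` `I_n) D k))); last first.
      by apply: leeD => //; exact: outer_measure_sigma_subadditive_tail.
    apply: le_trans (outer_measureU2 mu _ _); apply: le_outer_measure.
    move=> x [Xx Ux]; have [e e0 eU] := oU _ Ux.
    have [m] : exists m, A m x.
      have [m me] := ltr_add_invr e0; exists m; split=> // z Uz.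
      rewrite leNgt; apply/negP => zx; apply: Uz; apply: eU => /=.
      by apply: lt_trans zx _; rewrite add0r in me.
    have [mn Am|nm] := leqP m n.
      left; move: Am; rewrite -(subnK mn); elim: (n - m)%N => // k ih Am.
      by rewrite addSn; apply: Asub; exact: ih.
    rewrite -(subnK (ltnW nm)); elim: (m - n)%N => [|k ih Am]; first by left.
    have [Ak|nAk] := pselect (A (k + n)%N x); first exact: ih.
    by right; exists (k + n)%N => //=; rewrite ltnNge leq_addl.
  rewrite leeD2r//; apply: le_trans (le_outer_measure mu (A n `|` (X `&` ~` U)) _ _);
      last first.
    by move=> x [/AX//|[]].
  apply: (@separated_additive _ _ n.+1%:R^-1); first by rewrite invr_gt0 ltr0n.
  by move=> a b [_ ha] [_ /ha].
rewrite -[leRHS]adde0.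
have : (fun n => mu X + \sum_(n <= k <oo) mu (D k)) @ \oo --> mu X + 0.
  apply: cvgeD => //; first by rewrite fin_num_adde_defl.
  exact: cvg_cst.
move/cvg_lim => <- //; apply: lime_ge.
  by apply/cvg_ex; exists (mu X + 0); apply: cvgeD => //;
      [rewrite fin_num_adde_defl|exact: cvg_cst].
exact: nearW.
Qed.

End metric_outer_measure.

(** * Hausdorff measures: outer measure axioms, upper bounds by covers, lower bounds by mass
    distribution *)

Section hausdorff.
Local Open Scope ereal_scope.
Context {R : realType} {X : pointedType} (d : X -> X -> R).
Implicit Types (A B : set X) (s delta : R).

Lemma powdiam_ge0 s A : 0 <= powdiam d s A.
Proof. by rewrite /powdiam; case: ifP => // _; exact: poweR_ge0. Qed.

Lemma powdiam0 s : powdiam d s set0 = 0.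
Proof. by rewrite /powdiam eqxx. Qed.

Lemma diam0 : diam d set0 = -oo.
Proof.
by rewrite /diam (_ : [set _ | _ in _] = set0) ?ereal_sup0// -subset0 => _ [u [[]]].
Qed.

Lemma diam_ge A a b : A a -> A b -> (d a b)%:E <= diam d A.
Proof. by move=> Aa Ab; apply: ereal_sup_ubound; exists (a, b). Qed.

Lemma diam_le A (r : R) : (forall a b, A a -> A b -> (d a b <= r)%R) ->
  diam d A <= r%:E.
Proof.
by move=> h; apply: ge_ereal_sup => _ [[a b] [/= Aa Ab] <-]; rewrite lee_fin h.
Qed.

(* Exhibiting the content as an outer measure extension of the discrete
   sigma-algebra gives its sigma-subadditivity. *)
Let bounded_powdiam delta s
    (F : set (g_sigma_algebraType [set: set X])) : \bar R :=
  if diam d F <= delta%:E then powdiam d s F else +oo.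

Let hausdorff_contentE delta s :
  hausdorff_content d delta s = mu_ext (bounded_powdiam delta s).
Proof.
have b0 F : 0 <= bounded_powdiam delta s F.
  by rewrite /bounded_powdiam; case: ifP => // _; exact: powdiam_ge0.
apply/funext => A; apply/eqP; rewrite eq_le; apply/andP; split.
- apply: le_ereal_inf_tmp => _ [F [_ AF] <-].
  have [Fd|/existsNP[n Fn]] := pselect (forall n, diam d (F n) <= delta%:E).
    apply: ereal_inf_lbound; exists F => //.
    by apply: eq_eseriesr => n _; rewrite /bounded_powdiam Fd.
  rewrite (eseries_pinfty _ (k := n))//; first by rewrite leey.
    by move=> m _; rewrite gt_eqF// (lt_le_trans _ (b0 _))// ltNyr.
  by rewrite /bounded_powdiam; case: ifPn => // /Fn.
- apply: le_ereal_inf_tmp => _ [F [AF Fd] <-]; apply: ereal_inf_lbound.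
  exists F; last by apply: eq_eseriesr => n _; rewrite /bounded_powdiam Fd.
  by split=> // n; exact: sub_sigma_algebra.
Qed.

Lemma hausdorff_content_ge0 delta s A : 0 <= hausdorff_content d delta s A.
Proof.
apply: le_ereal_inf_tmp => _ [F _ <-]; apply: nneseries_ge0 => n _ _.
exact: powdiam_ge0.
Qed.

Lemma hausdorff_content_le delta s A (F : nat -> set X) :
  A `<=` \bigcup_n F n -> (forall n, diam d (F n) <= delta%:E) ->
  hausdorff_content d delta s A <= \sum_(0 <= n <oo) powdiam d s (F n).
Proof. by move=> AF Fd; apply: ereal_inf_lbound; exists F. Qed.

Lemma hausdorff_content_sub delta s A B : A `<=` B ->
  hausdorff_content d delta s A <= hausdorff_content d delta s B.
Proof.
move=> AB; apply: le_ereal_inf_tmp => _ [F [BF Fd] <-].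
by apply: hausdorff_content_le => //; exact: subset_trans BF.
Qed.

Lemma hausdorff_content_anti (e delta : R) s A : (e <= delta)%R ->
  hausdorff_content d delta s A <= hausdorff_content d e s A.
Proof.
move=> ed; apply: le_ereal_inf_tmp => _ [F [AF Fd] <-].
by apply: hausdorff_content_le => // n; rewrite (le_trans (Fd n))// lee_fin.
Qed.

Lemma hausdorff_content_le_measure delta s A : (0 < delta)%R ->
  hausdorff_content d delta s A <= hausdorff_measure d s A.
Proof. by move=> d0; apply: ereal_sup_ubound; exists delta. Qed.

Lemma hausdorff_measure_ge0 s A : 0 <= hausdorff_measure d s A.
Proof.
apply: le_trans (hausdorff_content_le_measure s A ltr01).
exact: hausdorff_content_ge0.
Qed.

Lemma hausdorff_measure_sub s : {homo hausdorff_measure d s : A B / A `<=` B >-> A <= B}.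
Proof.
move=> A B AB; apply: ge_ereal_sup => _ [e e0 <-].
exact: le_trans (hausdorff_content_sub _ _ AB) (hausdorff_content_le_measure _ _ e0).
Qed.

Lemma hausdorff_measure0 s : hausdorff_measure d s set0 = 0.
Proof.
apply/eqP; rewrite eq_le hausdorff_measure_ge0 andbT.
apply: ge_ereal_sup => _ [e e0 <-].
apply: le_trans (@hausdorff_content_le _ _ _ (fun=> set0) _ _) _ => //.
  by move=> n; rewrite diam0 leNye.
by rewrite eseries0// => n _ _; rewrite powdiam0.
Qed.

Lemma hausdorff_measure_subadditive s : sigma_subadditive (hausdorff_measure d s).
Proof.
move=> F; apply: ge_ereal_sup => _ [e e0 <-].
apply: (@le_trans _ _ (\sum_(0 <= n <oo) hausdorff_content d e s (F n))); last first.
  apply: lee_nneseries => [n _ _|n _]; first exact: hausdorff_content_ge0.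
  exact: hausdorff_content_le_measure.
rewrite hausdorff_contentE; apply: mu_ext_sigma_subadditive.
by move=> A; rewrite /bounded_powdiam; case: ifP => // _; exact: powdiam_ge0.
Qed.

(** A set of diameter below [e] cannot meet both sides, so at small scales a cover of the union
    splits into a cover of [A] and a cover of [B]. *)
Lemma hausdorff_measure_separated s A B (e : R) : (0 < e)%R ->
  (forall a b, A a -> B b -> (e <= d a b)%R) ->
  hausdorff_measure d s A + hausdorff_measure d s B <=
  hausdorff_measure d s (A `|` B).
Proof.
move=> e0 AB.
have content_separated delta : (delta < e)%R ->
    hausdorff_content d delta s A + hausdorff_content d delta s B <=
    hausdorff_content d delta s (A `|` B).
  move=> de; apply: le_ereal_inf_tmp => _ [F [ABF Fd] <-].
  (* Members of the cover that miss [C] are replaced by the empty set, which costs nothing. *)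
  pose meet (C : set X) n := if F n `&` C == set0 then set0 else F n.
  have cover C : C `<=` A `|` B -> hausdorff_content d delta s C <=
      \sum_(0 <= n <oo) powdiam d s (meet C n).
    move=> CAB; apply: hausdorff_content_le.
      move=> x Cx; have [n _ Fx] := ABF _ (CAB _ Cx).
      exists n => //; rewrite /meet; case: ifPn => // /eqP FC0.
      by rewrite -FC0.
    by move=> n; rewrite /meet; case: ifP => // _; rewrite diam0 leNye.
  apply: le_trans (leeD (cover A _) (cover B _)) _; [by left|by right|].
  rewrite -nneseriesD; try by move=> *; exact: powdiam_ge0.
  apply: lee_nneseries => [n _ _|n _].
    by rewrite adde_ge0// powdiam_ge0.
  rewrite /meet; case: ifPn => [_|/set0P[a [Fa Aa]]].
    rewrite powdiam0 add0e; case: ifP => // _.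
    by rewrite powdiam0 powdiam_ge0.
  case: ifPn => [_|/set0P[b [Fb Bb]]]; first by rewrite powdiam0 adde0.
  have := le_trans (diam_ge Fa Fb) (Fd n).
  by rewrite lee_fin => /(le_trans (AB _ _ Aa Bb)); rewrite leNgt de.
have [->|ABfin] := eqVneq (hausdorff_measure d s (A `|` B)) +oo.
  by rewrite leey.
have fin C : C `<=` A `|` B -> hausdorff_measure d s C \is a fin_num.
  move=> CAB; rewrite ge0_fin_numE ?hausdorff_measure_ge0//.
  by rewrite (le_lt_trans (hausdorff_measure_sub s CAB))// ltey.
have finA : hausdorff_measure d s A \is a fin_num by apply: fin; left.
have finB : hausdorff_measure d s B \is a fin_num by apply: fin; right.
rewrite -leeBrDr//; apply: ge_ereal_sup => _ [e1 e10 <-].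
rewrite leeBrDr// addeC.
have finC : hausdorff_content d e1 s A \is a fin_num.
  rewrite ge0_fin_numE ?hausdorff_content_ge0//.
  rewrite (le_lt_trans (hausdorff_content_le_measure s A e10))//.
  by rewrite -ge0_fin_numE// hausdorff_measure_ge0.
rewrite -leeBrDr//; apply: ge_ereal_sup => _ [e2 e20 <-].
rewrite leeBrDr// addeC.
pose m : R := (Num.min (e / 2) (Num.min e1 e2))%R.
have m0 : (0 < m)%R by rewrite !lt_min divr_gt0// e10.
have me : (m < e)%R by rewrite gt_min ltr_pdivrMr// ltr_pMr// ltr1n.
apply: le_trans (hausdorff_content_le_measure _ _ m0).
apply: le_trans (content_separated _ me).
by apply: leeD; apply: hausdorff_content_anti; rewrite !ge_min lexx !orbT.
Qed.

(** Box counting: a finite cover, padded with empty sets, is an admissible sequence. It yields the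
    finiteness of the measure of the dust and the volume of tubes. *)
Lemma hausdorff_measure_le_cover s A (B : R) :
  (forall x y, (0 <= d x y)%R) -> (0 <= s)%R ->
  (forall e, (0 < e)%R -> exists (I : finType) (F : I -> set X) (r : R),
    [/\ (0 <= r <= e)%R, A `<=` \bigcup_i F i,
      forall i a b, F i a -> F i b -> (d a b <= r)%R &
      (#|I|%:R * r `^ s <= B)%R]) ->
  hausdorff_measure d s A <= B%:E.
Proof.
move=> d0 s0 cov; apply: ge_ereal_sup => _ [e /cov[I [F [r [/andP[r0 re] AF Fr IB]]]] <-].
pose G n := if insub n is Some i then F (@enum_val I predT i) else set0.
have GF (i : I) : G (enum_rank i) = F i.
  rewrite /G; case: insubP => [j _ ji|]; last by rewrite ltn_ord.
  by congr F; apply: enum_rank_inj; rewrite enum_valK; exact: val_inj.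
have Gr n a b : G n a -> G n b -> (d a b <= r)%R.
  by rewrite /G; case: insubP => // j _ _; exact: Fr.
apply: (@le_trans _ _ (\sum_(0 <= n <oo) powdiam d s (G n))).
  apply: hausdorff_content_le.
    by move=> x /AF[i _ Fx]; exists (enum_rank i) => //; rewrite GF.
  by move=> n; apply: le_trans (diam_le (@Gr n)) _; rewrite lee_fin.
rewrite (nneseries_split 0 #|I|); last by move=> *; exact: powdiam_ge0.
rewrite add0n eseries0 ?adde0; last first.
  move=> n In _; rewrite /G; case: insubP => [j|]; last by rewrite powdiam0.
  by rewrite ltnNge In.
rewrite big_mkord; apply: (@le_trans _ _ (\sum_(i < #|I|) (r `^ s)%:E)).
  apply: lee_sum => i _; rewrite /powdiam; case: ifPn => [_|/set0P[a Ga]].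
    by rewrite lee_fin powR_ge0.
  rewrite -poweR_EFin; apply: gt0_ler_poweR => //; last exact: diam_le (@Gr i).
  - by rewrite in_itv/= leey andbT (le_trans _ (diam_ge Ga Ga))// lee_fin.
  - by rewrite in_itv/= leey andbT lee_fin.
by rewrite sumEFin sumr_const card_ord lee_fin -mulr_natl.
Qed.

End hausdorff.

Section hausdorff_lower_bound.
Context {R : realType} {X : pointedType} (d : X -> X -> R).
Hypothesis d_ge0 : forall x y, 0 <= d x y.

(* Mass distribution: the preimages under [P] of the members of a cover form a
   cover of [0, 1[, and each is contained in an interval of length
   [2 * C * diam ^ s]. *)
Lemma hausdorff_measure_holder_gt0 (s C : R) (P : R -> X) (A : set X) :
  0 <= s -> 0 < C -> P @` `[0, 1[ `<=` A ->
  {in `[0, 1[ &, forall r r', `|r - r'| <= C * d (P r) (P r') `^ s} ->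
  (0 < hausdorff_measure d s A)%E.
Proof.
move=> s0 C0 PA Pholder.
suff: ((2 * C)^-1%:E <= hausdorff_measure d s A)%E.
  by apply: lt_le_trans; rewrite lte_fin invr_gt0 mulr_gt0.
apply: le_trans (hausdorff_content_le_measure d s A ltr01).
apply: le_ereal_inf_tmp => _ [F [AF Fd] <-].
pose Q n := [set r : R | (r \in `[0, 1[%R) /\ F n (P r)].
pose D n := C * fine (diam d (F n)) `^ s.
pose J n := if Q n == set0 then set0
  else `[xget 0 (Q n) - D n, xget 0 (Q n) + D n]%classic.
have QJ n : Q n `<=` J n.
  move=> r Qr; rewrite /J; case: ifPn => [/eqP Q0|_]; first by rewrite -Q0.
  have [r01 Fr] := Qr; have [q01 Fq] : Q n (xget 0 (Q n)) by apply: xgetPex; exists r.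
  rewrite /= in_itv/= -ler_distl; apply: le_trans (Pholder _ _ r01 q01) _.
  rewrite ler_pM2l//; apply: ge0_ler_powR; rewrite ?nnegrE//.
    by apply: fine_ge0; apply: le_trans (diam_ge _ Fr Fq); rewrite lee_fin.
  have := diam_ge d Fr Fq; have := Fd n; case: (diam d (F n)) => //= x _.
have lJ n : (lebesgue_measure (J n) <= (2 * C)%:E * powdiam d s (F n))%E.
  rewrite /J; case: ifPn => [_|/set0P[r [r01 Fr]]].
    by rewrite measure0 mule_ge0 ?powdiam_ge0// lee_fin mulr_ge0// ltW.
  have D0 : 0 <= D n by rewrite mulr_ge0 ?powR_ge0// ltW.
  have -> : powdiam d s (F n) = (fine (diam d (F n)) `^ s)%:E.
    rewrite /powdiam ifF; last by apply/negbTE/set0P; exists (P r).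
    by have := diam_ge d Fr Fr; have := Fd n; case: (diam d (F n)).
  rewrite lebesgue_measure_itv/= -EFinM; case: ifPn => _.
    by rewrite -EFinB lee_fin /D; lra.
  by rewrite lee_fin mulr_ge0 ?powR_ge0// mulr_ge0 ?ltW.
have : ((1 : R)%:E <= \sum_(0 <= n <oo) lebesgue_measure (J n))%E.
  apply: (@le_trans _ _ (lebesgue_measure (`[0 : R, 1[%classic))).
    by rewrite lebesgue_measure_itv/= lte_fin ltr01 oppr0 adde0.
  apply: measure_sigma_subadditive => //.
    by move=> n; rewrite /J; case: ifP.
  move=> r r01; have [n _ Fr] : (\bigcup_n F n) (P r) by apply/AF/PA; exists r.
  by exists n => //; apply: QJ.
move=> /le_trans/(_ (lee_nneseries _ (fun n _ => lJ n))).
rewrite nneseriesZl; last by move=> *; exact: powdiam_ge0.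
move=> /(_ (fun _ _ _ => measure_ge0 _ _)) h.
have C20 : 0 < 2 * C by rewrite mulr_gt0.
by rewrite -(@lee_pmul2l _ (2 * C)%:E) ?lte_fin// -EFinM divff ?gt_eqF.
Qed.

End hausdorff_lower_bound.

Section planar_norm.
Context {R : realType}.
Implicit Types a b c d : R.

Lemma sqrtr_triangle a b c d :
  Num.sqrt ((a + c) ^+ 2 + (b + d) ^+ 2) <=
  Num.sqrt (a ^+ 2 + b ^+ 2) + Num.sqrt (c ^+ 2 + d ^+ 2).
Proof.
set p := Num.sqrt (a ^+ 2 + b ^+ 2); set q := Num.sqrt (c ^+ 2 + d ^+ 2).
have p0 : 0 <= p by exact: sqrtr_ge0.
have q0 : 0 <= q by exact: sqrtr_ge0.
have pE : p ^+ 2 = a ^+ 2 + b ^+ 2 by rewrite sqr_sqrtr// addr_ge0 ?sqr_ge0.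
have qE : q ^+ 2 = c ^+ 2 + d ^+ 2 by rewrite sqr_sqrtr// addr_ge0 ?sqr_ge0.
rewrite -(@ler_pXn2r _ 2)// ?nnegrE ?sqrtr_ge0 ?addr_ge0//.
rewrite sqr_sqrtr ?addr_ge0 ?sqr_ge0// (sqrrD p q) pE qE.
have h : a * c + b * d <= p * q.
  apply: le_trans (ler_norm _) _.
  rewrite -(@ler_pXn2r _ 2)// ?nnegrE ?mulr_ge0//.
  rewrite real_normK ?num_real// exprMn pE qE.
  by have := sqr_ge0 (a * d - b * c); lra.
lra.
Qed.

End planar_norm.

(** * The Heisenberg distance and the Borel measure that it generates *)

Section heisenberg_metric.
Context {R : realType}.
Implicit Types a b c : heis R.

Lemma hdist_ge0 a b : 0 <= hdist a b.
Proof. by rewrite /hdist; case: (hmul _ _) => [[x y] t]; exact: powR_ge0. Qed.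

Lemma hdistE a b : hdist a b = Num.sqrt (Num.sqrt (
  ((b.1.1 - a.1.1) ^+ 2 + (b.1.2 - a.1.2) ^+ 2) ^+ 2 +
  (b.2 - a.2 + 2 * (a.1.2 * b.1.1 - a.1.1 * b.1.2)) ^+ 2)).
Proof.
set N := (X in Num.sqrt (Num.sqrt X)).
have N0 : 0 <= N by rewrite addr_ge0// sqr_ge0.
rewrite -!powR12_sqrt ?powR_ge0// -powRrM.
rewrite /hdist /N; case: a b {N N0} => [[x y] t] [[x' y'] t'] /=.
by congr (_ `^ _); [ring|lra].
Qed.

Lemma hdist_sym a b : hdist a b = hdist b a.
Proof. by rewrite !hdistE; congr (Num.sqrt (Num.sqrt _)); ring. Qed.

Lemma hdistxx a : hdist a a = 0.
Proof.
rewrite hdistE (_ : _ + _ = 0) ?sqrtr0 ?sqrtr0//.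
by ring.
Qed.

(** With [z = u + iv], the squared distance is the modulus of the complex number [|z|^2 + iw].
    Composing two displacements adds these numbers and the cross term [2 * conj(z) * z'], of modulus
    [2 * |z| * |z'|], so the triangle inequality in the plane gives the square of the claim. *)
Lemma hdist_triangle a b c : hdist a c <= hdist a b + hdist b c.
Proof.
pose u := b.1.1 - a.1.1; pose v := b.1.2 - a.1.2.
pose u' := c.1.1 - b.1.1; pose v' := c.1.2 - b.1.2.
pose w := b.2 - a.2 + 2 * (a.1.2 * b.1.1 - a.1.1 * b.1.2).
pose w' := c.2 - b.2 + 2 * (b.1.2 * c.1.1 - b.1.1 * c.1.2).
pose n1 := Num.sqrt ((u ^+ 2 + v ^+ 2) ^+ 2 + w ^+ 2).
pose n2 := Num.sqrt ((u' ^+ 2 + v' ^+ 2) ^+ 2 + w' ^+ 2).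
have -> : hdist a b = Num.sqrt n1 by rewrite hdistE.
have -> : hdist b c = Num.sqrt n2 by rewrite hdistE.
have -> : hdist a c = Num.sqrt (Num.sqrt (
    (u ^+ 2 + v ^+ 2 + (u' ^+ 2 + v' ^+ 2) + 2 * (u * u' + v * v')) ^+ 2 +
    (w + w' + 2 * (u * v' - v * u')) ^+ 2)).
  by rewrite hdistE /w /w' /u /v /u' /v'; congr (Num.sqrt (Num.sqrt _)); ring.
have n10 : 0 <= n1 by exact: sqrtr_ge0.
have n20 : 0 <= n2 by exact: sqrtr_ge0.
pose m1 := u ^+ 2 + v ^+ 2; pose m2 := u' ^+ 2 + v' ^+ 2.
have m10 : 0 <= m1 by rewrite addr_ge0 ?sqr_ge0.
have m20 : 0 <= m2 by rewrite addr_ge0 ?sqr_ge0.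
have mn1 : m1 <= n1.
  by rewrite -{1}(ger0_norm m10) -sqrtr_sqr ler_wsqrtr// lerDl sqr_ge0.
have mn2 : m2 <= n2.
  by rewrite -{1}(ger0_norm m20) -sqrtr_sqr ler_wsqrtr// lerDl sqr_ge0.
have prodE : Num.sqrt ((2 * (u * u' + v * v')) ^+ 2 + (2 * (u * v' - v * u')) ^+ 2)
    = 2 * (Num.sqrt m1 * Num.sqrt m2).
  rewrite -sqrtrM// -[in RHS](@ger0_norm _ 2)// -[in RHS]sqrtr_sqr -sqrtrM ?sqr_ge0//.
  by congr Num.sqrt; rewrite /m1 /m2; ring.
rewrite -(@ler_pXn2r _ 2)// ?nnegrE ?addr_ge0 ?sqrtr_ge0// sqr_sqrtr ?sqrtr_ge0//.
apply: le_trans (sqrtr_triangle _ _ _ _) _.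
rewrite prodE (sqrrD (Num.sqrt n1)) !sqr_sqrtr//.
have := sqrtr_triangle m1 w m2 w'; rewrite -/n1 -/n2.
have : Num.sqrt m1 * Num.sqrt m2 <= Num.sqrt n1 * Num.sqrt n2.
  by apply: ler_pM; rewrite ?sqrtr_ge0// ler_wsqrtr.
by rewrite -/m1 -/m2; lra.
Qed.

End heisenberg_metric.

(** The same function carries two structures: this one bounds the measure of arbitrary sets, and the
    measure structure below, obtained from Caratheodory measurability of Borel sets, serves for
    integration. *)
HB.instance Definition _ (R : realType) := isOuterMeasure.Build R (heis R)
  (@heis_measure R) (hausdorff_measure0 hdist 4) (hausdorff_measure_ge0 hdist 4)
  (@hausdorff_measure_sub _ _ hdist 4)
  (@hausdorff_measure_subadditive _ _ hdist 4).

Section heisenberg_measure.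
Context {R : realType}.

Lemma heis_measure_caratheodory (A : set (heis R)) :
  measurable A -> (@heis_measure R).-caratheodory A.
Proof.
rewrite measurable_heisE; apply: smallest_sub.
  exact: (sigma_algebra_measurable (caratheodory_type (@heis_measure R))).
move=> U oU; apply: open_caratheodory (@hdist_triangle R) _ _ _.
  exact: hausdorff_measure_separated.
by move=> x Ux; apply/hdist_nbhsP; exact: open_nbhs_nbhs.
Qed.

Lemma heis_measure_semi_sigma_additive :
  semi_sigma_additive (@heis_measure R).
Proof.
move=> F mF tF mUF.
apply: (@caratheodory_measure_sigma_additive _ _ (@heis_measure R)) => //.
  by move=> n; exact: heis_measure_caratheodory.
exact: heis_measure_caratheodory.
Qed.

HB.instance Definition _ := isMeasure.Build _ _ _ (@heis_measure R)
  (hausdorff_measure0 hdist 4) (hausdorff_measure_ge0 hdist 4)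
  heis_measure_semi_sigma_additive.

End heisenberg_measure.

(** * Arclength parametrization of rectifiable paths *)

Section arclength.
Context {R : realType} {X : Type} (d : X -> X -> R).
Hypothesis d_ge0 : forall x y, 0 <= d x y.
Hypothesis dxx : forall x, d x x = 0.
Hypothesis d_sym : forall x y, d x y = d y x.
Hypothesis d_tri : forall x y z, d x z <= d x y + d y z.
Variable gamma : R -> X.
Implicit Types (a b c t : R) (s : seq R).

Fixpoint polygon_length a s : R :=
  if s is x :: s' then d (gamma a) (gamma x) + polygon_length x s' else 0.

Let path_variationE a b s :
  path_variation d a b gamma s = polygon_length a s.
Proof.
rewrite /path_variation; elim: s a => [a|x s ih a]; first by rewrite big_nil.
by rewrite big_nat_recl//= -ih.
Qed.

Let polygon_length_cat a s1 s2 : polygon_length a (s1 ++ s2) =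
  polygon_length a s1 + polygon_length (last a s1) s2.
Proof. by elim: s1 a => [a|x s1 ih a]/=; rewrite ?add0r// ih addrA. Qed.

Let polygon_le a b s : itv_partition a b s ->
  ((polygon_length a s)%:E <= path_length d gamma a b)%E.
Proof.
move=> sab; apply: ereal_sup_ubound; exists s => //.
by rewrite path_variationE.
Qed.

Let length_le a b (l : \bar R) :
  (forall s, itv_partition a b s -> ((polygon_length a s)%:E <= l)%E) ->
  (path_length d gamma a b <= l)%E.
Proof.
by move=> h; apply: ge_ereal_sup => _ [s sab <-]; rewrite path_variationE h.
Qed.

Let partition_ex a b : a <= b -> exists s, itv_partition a b s.
Proof.
rewrite le_eqVlt => /predU1P[->|ab]; first by exists [::]; split => /=.
by exists [:: b]; exact: itv_partition1.
Qed.

Lemma path_length_ge0 a b : a <= b -> (0 <= path_length d gamma a b)%E.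
Proof.
move=> /partition_ex[s sab]; apply: le_trans (polygon_le sab).
by rewrite lee_fin; elim: s a {sab} => //= x s ih a; rewrite addr_ge0.
Qed.

Let partition_split a b c s : itv_partition a b s -> a <= c <= b ->
  exists s1 s2, [/\ itv_partition a c s1, itv_partition c b s2 &
    polygon_length a s <= polygon_length a s1 + polygon_length c s2].
Proof.
elim: s a => [a [_ /= /eqP ->] acb|x s ih a [/= /andP[ax xs] sb] /andP[ac cb]].
  have -> : c = b by apply/eqP; rewrite eq_le andbC.
  by exists [::], [::]; split=> //=; rewrite addr0.
have [cx|xc] := ltP c x.
  have [ca|ca] := eqVneq a c.
    exists [::], (x :: s); split; [|by split; rewrite //= -?ca ?ax|].
      by split => //=; rewrite ca.
    by rewrite /= add0r ca.
  exists [:: c], (x :: s); split; last by rewrite /= addr0 addrA lerD2r.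
    by apply: itv_partition1; rewrite lt_def eq_sym ca.
  by split; rewrite //= cx.
have [|s1 [s2 [s1c s2b len]]] := ih x (conj xs sb); first by rewrite xc.
exists (x :: s1), s2; split=> //; last by rewrite /= -addrA lerD2l.
by case: s1c => s1x s1c; split; rewrite //= ax.
Qed.

Let path_length_sub_add a b c : a <= c <= b ->
  (path_length d gamma a b <= path_length d gamma a c + path_length d gamma c b)%E.
Proof.
move=> acb; apply: length_le => s sab.
have [s1 [s2 [h1 h2 h]]] := partition_split sab acb.
apply: le_trans (leeD (polygon_le h1) (polygon_le h2)).
by rewrite -EFinD lee_fin.
Qed.

Let path_length_polygon a b c s : a <= c -> itv_partition c b s ->
  (path_length d gamma a c + (polygon_length c s)%:E <= path_length d gamma a b)%E.
Proof.
move=> ac scb; rewrite -leeBrDr//; apply: length_le => s1 s1ac.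
rewrite leeBrDr// -EFinD.
have -> : polygon_length a s1 + polygon_length c s = polygon_length a (s1 ++ s).
  by rewrite polygon_length_cat; case: s1ac => _ /eqP ->.
by apply: polygon_le; exact: itv_partition_cat scb.
Qed.

Hypothesis gamma_cont : {in `[0, 1], forall t (e : R), 0 < e ->
  exists2 eta, 0 < eta & {in `[0, 1], forall t',
    `|t - t'| < eta -> d (gamma t) (gamma t') < e}}.
Hypothesis gamma_fin : (path_length d gamma 0 1 < +oo)%E.

Let v t := fine (path_length d gamma 0 t).

Let vE t : t \in `[0, 1] -> path_length d gamma 0 t = (v t)%:E.
Proof.
rewrite in_itv/= => /andP[t0 t1]; rewrite fineK// ge0_fin_numE ?path_length_ge0//.
apply: le_lt_trans gamma_fin; have [s /(path_length_polygon t0)] := partition_ex t1.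
apply: le_trans; rewrite leeDl// lee_fin.
by elim: s t {t0 t1} => //= x s ih t; rewrite addr_ge0.
Qed.

Let v_dist t t' : t \in `[0, 1] -> t' \in `[0, 1] -> t <= t' ->
  v t + d (gamma t) (gamma t') <= v t'.
Proof.
move=> t01 t'01; rewrite le_eqVlt => /predU1P[->|tt']; first by rewrite dxx addr0.
rewrite -lee_fin EFinD -!vE//.
have := path_length_polygon _ (itv_partition1 tt'); rewrite /= addr0; apply.
by move: t01; rewrite in_itv => /andP[].
Qed.

(** Left continuity of the length function. In a polygon almost as long as the path up to [t], the
    last vertex is moved back from [t] to [r]; by continuity of [gamma] this loses little. *)
Let v_left t (e : R) : t \in `[0, 1] -> 0 < t -> 0 < e ->
  exists2 u, 0 <= u < t & forall r, u < r < t -> v t <= v r + e.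
Proof.
move=> t01 t0 e0.
have [eta eta0 geta] := gamma_cont t01 (divr_gt0 e0 (ltr0n _ 2)).
have t1 : t <= 1 by move: t01; rewrite in_itv/= => /andP[].
have [s st sv] : exists2 s, itv_partition 0 t s & v t - e / 2 < polygon_length 0 s.
  apply: contrapT => nex; have : (path_length d gamma 0 t <= (v t - e / 2)%:E)%E.
    apply: length_le => s st; rewrite lee_fin leNgt; apply/negP => vs.
    by apply: nex; exists s.
  by rewrite vE// lee_fin; lra.
move: st sv; case/lastP: s => [/itv_partition_nil t00|s y [sp]].
  by rewrite t00 ltxx in t0.
rewrite last_rcons => /eqP yt; move: sp; rewrite yt rcons_path => /andP[sp lt].
rewrite -cats1 polygon_length_cat/= addr0 => sv.
have l0 : 0 <= last 0 s by apply: (itv_partition_le (s := s)); split.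
exists (Num.max (last 0 s) (t - eta)).
  by rewrite le_max l0 /= gt_max lt/= ltrBlDr ltrDl.
move=> r /andP[]; rewrite gt_max => /andP[lr etar] rt.
have r01 : r \in `[0, 1].
  by rewrite in_itv/= (le_trans l0 (ltW lr)) (le_trans (ltW rt)).
have : d (gamma t) (gamma r) < e / 2.
  by apply: geta => //; rewrite gtr0_norm ?subr_gt0//; lra.
have := d_tri (gamma (last 0 s)) (gamma r) (gamma t); rewrite (d_sym (gamma r)).
have : polygon_length 0 (s ++ [:: r]) <= v r.
  rewrite -lee_fin -vE//; apply: polygon_le; split; last by rewrite last_cat.
  by rewrite cats1 rcons_path sp.
rewrite polygon_length_cat/= addr0; lra.
Qed.

(** The mirror image, with a polygon from [t] to 1 whose start is moved forward to [r]. Additivity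
    of length converts the polygon after [r] into a bound on [v r]. *)
Let v_right t (e : R) : t \in `[0, 1] -> t < 1 -> 0 < e ->
  exists2 u, t < u <= 1 & forall r, t < r < u -> v r <= v t + e.
Proof.
move=> t01 t1 e0.
have [eta eta0 geta] := gamma_cont t01 (divr_gt0 e0 (ltr0n _ 2)).
have t0 : 0 <= t by move: t01; rewrite in_itv/= => /andP[].
have i01 : 1 \in `[0, 1 : R] by rewrite in_itv/= lexx ler01.
have [s st sv] : exists2 s, itv_partition t 1 s &
    v 1 - v t - e / 2 < polygon_length t s.
  apply: contrapT => nex.
  have : (path_length d gamma t 1 <= (v 1 - v t - e / 2)%:E)%E.
    apply: length_le => s st; rewrite lee_fin leNgt; apply/negP => vs.
    by apply: nex; exists s.
  have : (path_length d gamma 0 1 <= path_length d gamma 0 t + path_length d gamma t 1)%E.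
    by apply: path_length_sub_add; rewrite t0 ltW.
  rewrite !vE//; case: (path_length d gamma t 1) => [x||]//.
  by rewrite -EFinD !lee_fin; lra.
move: st sv; case: s => [/itv_partition_nil t00|x s [/= /andP[tx xs] sp] sv].
  by rewrite t00 ltxx in t1.
have x1 : x <= 1 by apply: (itv_partition_le (s := s)); split.
exists (Num.min x (t + eta)).
  by rewrite lt_min tx ltrDl eta0/= ge_min x1.
move=> r /andP[tr]; rewrite lt_min => /andP[rx rt].
have r0 : 0 <= r by rewrite (le_trans t0)// ltW.
have r01 : r \in `[0, 1] by rewrite in_itv/= r0 (le_trans (ltW rx)).
have : d (gamma t) (gamma r) < e / 2.
  by apply: geta => //; rewrite ltr0_norm ?subr_lt0//; lra.
have := d_tri (gamma t) (gamma r) (gamma x).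
have rxs : itv_partition r 1 (x :: s) by split; rewrite //= rx.
have := path_length_polygon r0 rxs; rewrite !vE// -EFinD lee_fin/=.
lra.
Qed.

Let ell := fine (path_length d gamma 0 1).

Let v0 : v 0 = 0.
Proof.
rewrite /v; suff -> : path_length d gamma 0 0 = 0%E by [].
apply/eqP; rewrite eq_le path_length_ge0// andbT; apply: length_le => s.
by move=> /itv_partitionxx ->.
Qed.

(** The length function takes every value in between: at the supremum [T] of the times of length at
    most [l], one-sided continuity excludes both a larger and a smaller value. Hence the choice made
    in [arclength_param] never falls back on its default. *)
Lemma arclength_paramP (l : R) : l \in `[0, ell] ->
  exists2 t, t \in `[0, 1] & v t = l /\ arclength_param d gamma l = gamma t.
Proof.
rewrite in_itv/= => /andP[l0 lell].
suff [t t01 vt] : exists2 t, t \in `[0, 1] & v t = l.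
  have [/= x01 vx] : [set t | `[0%R, 1%R]%classic t /\ path_length d gamma 0 t = l%:E]
      (xget 0%R [set t | `[0%R, 1%R]%classic t /\ path_length d gamma 0 t = l%:E]).
    by apply: xgetPex; exists t; split=> //; rewrite vE// vt.
  by eexists; [exact: x01|split=> //; rewrite /v vx].
pose A := [set t | t \in `[0, 1] /\ v t <= l].
have A0 : A 0 by split; rewrite ?in_itv/= ?lexx ?ler01// v0.
have A1 : ubound A 1 by move=> t [] /itvP ->.
have hA : has_sup A by split; [exists 0|exists 1].
pose T := sup A.
have T01 : T \in `[0, 1].
  by rewrite in_itv/= (sup_upper_bound hA)//= ge_sup//; exists 0.
have v_nd t t' : t \in `[0, 1] -> t' \in `[0, 1] -> t <= t' -> v t <= v t'.
  by move=> h h' /(v_dist h h'); apply: le_trans; rewrite lerDl.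
exists T => //; apply/eqP; rewrite eq_le; apply/andP; split.
- rewrite leNgt; apply/negP => lT.
  have T0 : 0 < T.
    rewrite lt_neqAle (itvP T01) andbT; apply: contraTneq lT => <-.
    by rewrite v0 -leNgt.
  have e0 : 0 < (v T - l) / 2 by rewrite divr_gt0// subr_gt0.
  have [u /andP[u0 uT] hu] := v_left T01 T0 e0.
  suff : T <= u by rewrite leNgt uT.
  apply: ge_sup; first by exists 0.
  move=> t At; rewrite leNgt; apply/negP => ut; have [t01 vt] := At.
  have := sup_upper_bound hA At; rewrite -/T le_eqVlt => /predU1P[tT|tT].
    by move: lT; rewrite -tT ltNge vt.
  by have := hu t; rewrite ut tT => /(_ isT); lra.
- rewrite leNgt; apply/negP => Tl.
  have T1 : T < 1.
    rewrite lt_neqAle (itvP T01) andbT; apply: contraTneq Tl => ->.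
    by rewrite -leNgt.
  have e0 : 0 < (l - v T) / 2 by rewrite divr_gt0// subr_gt0.
  have [u /andP[Tu u1] hu] := v_right T01 T1 e0.
  have T0 : 0 <= T by rewrite (itvP T01).
  have : A ((T + u) / 2).
    split; first by rewrite in_itv/=; apply/andP; split; lra.
    have /hu : T < (T + u) / 2 < u by apply/andP; split; lra.
    lra.
  by move=> /(sup_upper_bound hA); rewrite -/T; lra.
Qed.

Lemma arclength_param_lipschitz (l l' : R) : l \in `[0, ell] -> l' \in `[0, ell] ->
  d (arclength_param d gamma l) (arclength_param d gamma l') <= `|l - l'|.
Proof.
move=> /arclength_paramP[t t01 [<- ->]] /arclength_paramP[t' t'01 [<- ->]].
have [tt'|/ltW tt'] := leP t t'.
  by rewrite distrC (le_trans _ (ler_norm _))// lerBrDl v_dist.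
by rewrite d_sym (le_trans _ (ler_norm _))// lerBrDl v_dist.
Qed.

(** The time chosen for length 0 may differ from 0, but no length is spent in between. The
    conclusion is about the distance because [d] is not assumed to separate points. *)
Lemma arclength_param_start : d (gamma 0) (arclength_param d gamma 0) = 0.
Proof.
have i00 : 0 \in `[0, ell] by rewrite in_itv/= lexx fine_ge0 ?path_length_ge0.
have [t t01 [vt ->]] := arclength_paramP i00.
apply/eqP; rewrite eq_le d_ge0 andbT.
have := v_dist _ t01; rewrite vt => /(_ 0); rewrite v0 add0r; apply.
  by rewrite in_itv/= lexx ler01.
by rewrite (itvP t01).
Qed.

Lemma arclength_param_end : d (gamma 1) (arclength_param d gamma ell) = 0.
Proof.
have i01 : 1 \in `[0, 1 : R] by rewrite in_itv/= lexx ler01.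
have iee : ell \in `[0, ell] by rewrite in_itv/= lexx fine_ge0 ?path_length_ge0.
have [t t01 [vt ->]] := arclength_paramP iee.
apply/eqP; rewrite eq_le d_ge0 andbT d_sym.
have t1 : t <= 1 by rewrite (itvP t01).
by have := v_dist t01 i01 t1; rewrite vt -/ell -[v 1]/ell gerDl.
Qed.

End arclength.

(** * Line integrals of weighted indicators of supports *)

Section lipschitz_support.
Context {R : realType}.
Implicit Types (w : R -> R) (L l : R).

(** Composition with the projection [clamp] onto the interval extends [w] to a continuous function
    on the line, whose nonzero set is Borel. *)
Lemma lipschitz_support_measurable w L l :
  {in `[0, l] &, forall s s', `|w s - w s'| <= L * `|s - s'|} ->
  measurable (`[0, l]%classic `&` [set s | w s != 0]).
Proof.
move=> wL.
have [l0|l0] := ltP l 0.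
  by rewrite set_itv_ge ?set0I// bnd_simp -ltNge.
pose clamp (s : R) : R := Num.min (Num.max 0 s) l.
have clamp_in s : clamp s \in `[0, l].
  by rewrite in_itv/= le_min ge_min !le_max !lexx l0 orbT.
have clamp_lip s s' : `|clamp s - clamp s'| <= `|s - s'|.
  have min_lip (x y n : R) : x - y <= n -> y - x <= n ->
      `|Num.min x l - Num.min y l| <= n.
    by case: (leP x l) => ?; case: (leP y l) => ? ? ?; rewrite ler_norml;
      apply/andP; split; lra.
  have max_lip (x y n : R) : x - y <= n -> y - x <= n ->
      `|Num.max 0 x - Num.max 0 y| <= n.
    by case: (leP 0 x) => ?; case: (leP 0 y) => ? ? ?; rewrite ler_norml;
      apply/andP; split; lra.
  have dist_le (x y n : R) : `|x - y| <= n -> x - y <= n /\ y - x <= n.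
    by rewrite ler_norml => /andP[? ?]; split; lra.
  have [h1 h2] := dist_le _ _ _ (lexx `|s - s'|).
  by have [h3 h4] := dist_le _ _ _ (max_lip _ _ _ h1 h2); exact: min_lip.
have cw : continuous (w \o clamp).
  move=> s; apply/cvgrPdist_lt => e e0; near=> s'.
  apply: le_lt_trans (wL _ _ (clamp_in s) (clamp_in s')) _.
  apply: (@le_lt_trans _ _ (`|L| * `|s - s'|)).
    apply: (@le_trans _ _ (`|L| * `|clamp s - clamp s'|)).
      by rewrite ler_wpM2r// ler_norm.
    by rewrite ler_wpM2l.
  apply: (@le_lt_trans _ _ ((`|L| + 1) * `|s - s'|)).
    by rewrite ler_wpM2r// lerDl.
  rewrite mulrC -ltr_pdivlMr ?ltr_wpDl//.
  near: s'; apply: cvgr_dist_lt => //.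
  by rewrite divr_gt0// ltr_wpDl.
have -> : `[0, l]%classic `&` [set s | w s != 0] =
    `[0, l]%classic `&` ((w \o clamp) @^-1` (~` [set 0])).
  apply/seteqP; split => s [/= s0l ws]; split=> //=.
    rewrite (_ : clamp s = s); first by move/eqP: ws.
    by move: s0l; rewrite in_itv/= /clamp => /andP[h h']; rewrite max_r// min_l.
  apply/eqP; rewrite (_ : clamp s = s) in ws => //.
  by move: s0l; rewrite in_itv/= /clamp => /andP[h h']; rewrite max_r// min_l.
apply: measurableI => //; rewrite -[X in measurable X]setTI.
apply: continuous_measurable_fun cw _ _ _ => //.
by apply: measurableC; exact: measurable_set1.
Unshelve. all: by end_near. Qed.

(* Apart from the parts before its first zero and after its last one,
   [w] contributes nothing to [w 0 - w l]. *)
Lemma lipschitz_support_le w L l : 0 <= L -> 0 <= l ->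
  {in `[0, l] &, forall s s', `|w s - w s'| <= L * `|s - s'|} ->
  (`|w 0 - w l|%:E <=
    L%:E * lebesgue_measure (`[0%R, l]%classic `&` [set s | w s != 0%R]))%E.
Proof.
move=> L0 l0 wL; have mS := lipschitz_support_measurable wL.
set S := _ `&` _ in mS *.
have i0 : 0 \in `[0, l] by rewrite in_itv/= lexx.
have il : l \in `[0, l] by rewrite in_itv/= lexx andbT.
pose Z := [set s | s \in `[0, l] /\ w s = 0].
have [[z [z0l wz]]|noZ] := pselect (exists z, Z z); last first.
  have -> : S = `[0, l]%classic.
    apply/seteqP; split=> s; first by case.
    by move=> s0l; split=> //=; apply/eqP => ws; apply: noZ; exists s.
  rewrite lebesgue_measure_itv/= lte_fin; case: ltP => [l1|l1].
    rewrite oppr0 adde0 -EFinM lee_fin (le_trans (wL _ _ i0 il))//.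
    by rewrite sub0r normrN ger0_norm.
  have -> : l = 0 by apply/eqP; rewrite eq_le l1.
  by rewrite subrr normr0 mule0.
have infZ : has_inf Z by split; [exists z|exists 0 => s [/itvP ->]].
have supZ : has_sup Z by split; [exists z|exists l => s [/itvP ->]].
pose a := inf Z; pose b := sup Z.
have a0 : 0 <= a by apply: lb_le_inf; [exists z|move=> s [/itvP ->]].
have bl : b <= l by apply: ge_sup; [exists z|move=> s [/itvP ->]].
have az : a <= z by apply: ge_inf; [exact: infZ.2|].
have zb : z <= b by apply: sup_upper_bound.
have wa : `|w 0| <= L * a.
  apply/ler_addgt0Pr => e e0.
  have e1 : 0 < e / (L + 1) by rewrite divr_gt0// ltr_wpDl.
  have [s [s0l ws] sa] := inf_adherent e1 infZ.
  have := wL _ _ i0 s0l; rewrite ws subr0 sub0r normrN [X in _ * X]ger0_norm ?(itvP s0l)//.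
  move=> /le_trans; apply; rewrite -/a in sa.
  apply: (@le_trans _ _ (L * (a + e / (L + 1)))).
    by rewrite ler_wpM2l// ltW.
  rewrite mulrDr lerD2l mulrCA ger_pMr// ler_pdivrMr ?mul1r ?lerDl//.
  by rewrite ltr_wpDl.
have wb : `|w l| <= L * (l - b).
  apply/ler_addgt0Pr => e e0.
  have e1 : 0 < e / (L + 1) by rewrite divr_gt0// ltr_wpDl.
  have [s [s0l ws] sb] := sup_adherent e1 supZ.
  have := wL _ _ il s0l; rewrite ws subr0 [X in _ * X]ger0_norm ?subr_ge0 ?(itvP s0l)//.
  move=> /le_trans; apply; rewrite -/b in sb.
  apply: (@le_trans _ _ (L * (l - b + e / (L + 1)))).
    by rewrite ler_wpM2l//; lra.
  rewrite mulrDr lerD2l mulrCA ger_pMr// ler_pdivrMr ?mul1r ?lerDl//.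
  by rewrite ltr_wpDl.
have aS : `[0, a[%classic `|` `]b, l]%classic `<=` S.
  move=> s []; rewrite /= in_itv/= => /andP[h1 h2].
    have s0l : s \in `[0, l] by rewrite in_itv/=; apply/andP; split; lra.
    split=> //=; apply/eqP => ws; move: h2; rewrite ltNge => /negP; apply.
    by apply: ge_inf; [exact: infZ.2|].
  have s0l : s \in `[0, l] by rewrite in_itv/=; apply/andP; split; lra.
  split=> //=; apply/eqP => ws; move: h1; rewrite ltNge => /negP; apply.
  by apply: sup_upper_bound.
apply: (@le_trans _ _ (L%:E * (a%:E + (l - b)%:E)))%E.
  rewrite -EFinD -EFinM lee_fin (le_trans (ler_normB _ _))//.
  by rewrite mulrDr lerD.
apply: lee_pmul => //; first by rewrite -EFinD lee_fin; lra.
apply: le_trans (le_measure lebesgue_measure _ _ aS); rewrite ?inE//; last first.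
  by apply: measurableU.
rewrite measureU//; last first.
  by apply/seteqP; split => // s []/=; rewrite !in_itv/= => /andP[? ?] /andP[? ?]; lra.
apply: leeD; rewrite [leRHS]lebesgue_measure_itv/= lte_fin.
  by case: ltP => [_|a1]; rewrite ?oppr0 ?adde0// lee_fin.
by case: ltP => [_|a1]; rewrite -?EFinB// lee_fin; lra.
Qed.

End lipschitz_support.

Section weighted_indicators.
Local Open Scope ereal_scope.
Context {R : realType}.

Definition weighted_indic {T : Type} (c : nat -> R) (A : nat -> set T) (x : T) : \bar R :=
  \sum_(0 <= k <oo) (c k * \1_(A k) x)%:E.

Section type.
Context {T : Type} (c : nat -> R) (A : nat -> set T).
Hypothesis c0 : forall k, (0 <= c k)%R.

Let term_ge0 k x : 0 <= (c k * \1_(A k) x)%:E.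
Proof. by rewrite lee_fin mulr_ge0// indicE ler0n. Qed.

Lemma weighted_indic_ge0 x : 0 <= weighted_indic c A x.
Proof. by apply: nneseries_ge0 => k _ _; exact: term_ge0. Qed.

Lemma weighted_indic_ge k x : A k x -> (c k)%:E <= weighted_indic c A x.
Proof.
move=> Akx; rewrite /weighted_indic (@nneseriesD1 _ _ k)//=.
  rewrite indicE mem_set// mulr1 leeDl//.
  by apply: nneseries_ge0 => m _ _; exact: term_ge0.
Qed.

End type.

Section measurable_type.
Context d (T : measurableType d) (c : nat -> R) (A : nat -> set T).
Hypothesis c0 : forall k, (0 <= c k)%R.
Hypothesis mA : forall k, measurable (A k).

Let measurable_term k D : measurable_fun D (fun x : T => (c k * \1_(A k) x)%:E).
Proof.
by apply/measurable_EFinP; apply: measurable_funM => //; exact: measurable_indic.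
Qed.

Lemma measurable_weighted_indic D : measurable_fun D (weighted_indic c A).
Proof.
apply: ge0_emeasurable_sum => [k x _ _|k _]; last exact: measurable_term.
by rewrite lee_fin mulr_ge0// indicE ler0n.
Qed.

Lemma integral_weighted_indic (mu : {measure set T -> \bar R}) :
  \int[mu]_x weighted_indic c A x = \sum_(0 <= k <oo) (c k)%:E * mu (A k).
Proof.
rewrite integral_nneseries//; last first.
  by move=> k x _; rewrite lee_fin mulr_ge0// indicE ler0n.
apply: eq_eseriesr => k _; under eq_integral do rewrite EFinM.
rewrite ge0_integralZl_EFin//; last first.
  by apply/measurable_EFinP; exact: measurable_indic.
by rewrite integral_indic// setIT.
Qed.

End measurable_type.
End weighted_indicators.

Section line_integral_bound.
Local Open Scope ereal_scope.
Context {R : realType} {X : Type} (d : X -> X -> R).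
Hypothesis d_ge0 : forall x y, (0 <= d x y)%R.
Hypothesis dxx : forall x, d x x = 0%R.
Hypothesis d_sym : forall x y, d x y = d y x.
Hypothesis d_tri : forall x y z, (d x z <= d x y + d y z)%R.
Variable gamma : R -> X.
Hypothesis gamma_cont : {in `[0%R, 1%R], forall t (e : R), (0 < e)%R ->
  exists2 eta, (0 < eta)%R & {in `[0%R, 1%R], forall t',
    (`|t - t'| < eta)%R -> (d (gamma t) (gamma t') < e)%R}}.
Hypothesis gamma_fin : path_length d gamma 0 1 < +oo.
Variables (u : nat -> X -> R) (L kap : nat -> R) (p : R).
Hypothesis p0 : (0 < p)%R.
Hypothesis L0 : forall k, (0 <= L k)%R.
Hypothesis kap0 : forall k, (0 < kap k)%R.
Hypothesis kap_sum : forall n, (\sum_(k < n) kap k <= 1)%R.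
Hypothesis uL : forall k x y, (`|u k x - u k y| <= L k * d x y)%R.

Let N k := [set x | u k x != 0%R].
Let energy := weighted_indic (fun k => ((L k / kap k) `^ p)%R) N.

(* Where [u k] does not vanish, the energy is at least [(L k / kap k) `^ p], so
   its p-th root dominates the convex combination of the [L k / kap k]. *)
Lemma sum_lipschitz_le_energy n x :
  (\sum_(k < n) L k * \1_(N k) x)%:E <= energy x `^ p^-1.
Proof.
have h k : (L k * \1_(N k) x)%:E <= (kap k)%:E * energy x `^ p^-1.
  have kE0 : 0 <= (kap k)%:E * energy x `^ p^-1.
    by rewrite mule_ge0 ?poweR_ge0// lee_fin ltW.
  rewrite indicE; have [Nx|_] := boolP (x \in N k); last by rewrite mulr0.
  rewrite mulr1; have /(@gt0_ler_poweR _ p^-1) : ((L k / kap k) `^ p)%:E <= energy x.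
    by apply: weighted_indic_ge; [move=> m; exact: powR_ge0|exact: set_mem Nx].
  rewrite poweR_EFin -powRrM divff ?gt_eqF// powRr1 ?divr_ge0 ?(ltW (kap0 k))//.
  rewrite !in_itv/= !leey !andbT lee_fin powR_ge0 invr_ge0 (ltW p0).
  move=> /(_ isT isT); rewrite weighted_indic_ge0 => [/(_ isT)|m]; last exact: powR_ge0.
  have -> : (L k)%:E = (kap k)%:E * (L k / kap k)%:E.
    by rewrite -EFinM mulrC divfK ?gt_eqF.
  by move=> hk; apply: lee_wpmul2l => //; rewrite lee_fin ltW.
rewrite -sumEFin; apply: (@le_trans _ _ (\sum_(k < n) (kap k)%:E * energy x `^ p^-1)).
  by apply: lee_sum.
rewrite -ge0_sume_distrl; last by move=> k _; rewrite lee_fin ltW.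
rewrite sumEFin -[leRHS]mul1e; apply: lee_wpmul2r; first exact: poweR_ge0.
by rewrite lee_fin.
Qed.

(** Along the arclength parametrization [u k] is [L k]-Lipschitz, so its increment is at most the
    integral of [L k] over the parameters where it is nonzero. The sum of these integrands is below
    the root of the energy, uniformly in [n]. *)
Lemma sum_increments_le_line_integral n :
  (\sum_(k < n) `|u k (gamma 0) - u k (gamma 1)|)%:E <=
  line_integral d gamma (fun x => energy x `^ p^-1).
Proof.
rewrite /line_integral; set ell := fine _; set g := arclength_param d gamma.
have ell0 : (0 <= ell)%R.
  by apply: fine_ge0; exact: (path_length_ge0 d_ge0 gamma ler01).
have uLip k : {in `[0, ell]%R &, forall s s',
    (`|u k (g s) - u k (g s')| <= L k * `|s - s'|)%R}.
  move=> s s' sl s'l; apply: le_trans (uL _ _ _) _; rewrite ler_wpM2l//.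
  exact: (arclength_param_lipschitz d_ge0 dxx d_sym d_tri gamma_cont gamma_fin).
pose D := `[0%R, ell]%classic.
have mD : measurable D by exact: measurable_itv.
pose S k := D `&` [set s | u k (g s) != 0%R].
have mS k : measurable (S k) by exact: lipschitz_support_measurable (uLip k).
have eqN s k : D s -> \1_(S k) s = \1_(N k) (g s) :> R.
  move=> Ds; rewrite !indicE; congr (_%:R); congr nat_of_bool.
  by apply/idP/idP => /set_mem h; apply/mem_set; [case: h|split].
apply: (@le_trans _ _ (\int[lebesgue_measure]_(s in D) (\sum_(k < n) (L k * \1_(S k)
    s)%:E))).
  rewrite -sumEFin ge0_integral_sum//; last 2 first.
  - move=> k; apply/measurable_EFinP; apply: measurable_funM => //.
    apply: measurable_indic; exact: mS.
  - by move=> k s _; rewrite lee_fin mulr_ge0// indicE ler0n.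
  apply: lee_sum => k _; under eq_integral do rewrite EFinM.
  rewrite ge0_integralZl_EFin//; last first.
    by apply/measurable_EFinP; apply: measurable_indic; exact: mS.
  rewrite integral_indic//; last exact: mS.
  rewrite setIC [D `&` S k](_ : _ = S k); last first.
    by rewrite /S setIA setIid.
  have same x y : d x y = 0%R -> u k x = u k y.
    move=> dxy; apply/eqP; rewrite -subr_eq0 -normr_le0.
    by rewrite (le_trans (uL _ _ _))// dxy mulr0.
  rewrite (same (gamma 0) (g 0%R));
      last exact: (arclength_param_start d_ge0 dxx d_sym d_tri gamma_cont gamma_fin).
  rewrite (same (gamma 1) (g ell));
      last exact: (arclength_param_end d_ge0 dxx d_sym d_tri gamma_cont gamma_fin).
  exact: lipschitz_support_le (uLip k).
apply: ge0_le_integral => //.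
- by move=> s _; apply: sume_ge0 => k _; rewrite lee_fin mulr_ge0// indicE ler0n.
- apply: emeasurable_sum => k; apply/measurable_EFinP; apply: measurable_funM => //.
  apply: measurable_indic; exact: mS.
- apply: (measurableT_comp (measurable_poweR _)).
  apply: (eq_measurable_fun (weighted_indic (fun k => ((L k / kap k) `^ p)%R) S)).
    move=> s /set_mem Ds; apply: eq_eseriesr => k _; by rewrite eqN.
  by apply: measurable_weighted_indic => // k; exact: powR_ge0.
- move=> s Ds; apply: le_trans (sum_lipschitz_le_energy n (g s)).
  by rewrite -sumEFin; apply: lee_sum => k _; rewrite eqN.
Qed.

End line_integral_bound.

(** * Binary digits, weighted digit sums and dusts in the plane *)

Section binary_digits.
Context {R : realType}.
Implicit Types (r : R) (m k n : nat).

(** The digit of weight [2 ^- k.+1]. For a dyadic [r], truncation selects the expansion ending in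
    zeros. *)
Definition bit r k : bool := odd (Num.truncn (r * 2 ^+ k.+1)).

Let truncn_half (x : R) : 0 <= x -> (Num.truncn (x * 2))./2 = Num.truncn x.
Proof.
move=> x0; apply/esym/truncn_def.
have x20 : 0 <= x * 2 by rewrite mulr_ge0.
have /andP[] := truncn_itv x20; set m := Num.truncn _.
rewrite -!natr1; have -> : m%:R = (odd m)%:R + 2 * (m./2)%:R :> R.
  by rewrite -{1}(odd_double_half m) natrD -mul2n natrM.
by case: (odd m) => /= h1 h2; apply/andP; split; lra.
Qed.

Lemma bits_eq_truncn m r r' : 0 <= r < 1 -> 0 <= r' < 1 ->
  (forall k, (k < m)%N -> bit r k = bit r' k) ->
  Num.truncn (r * 2 ^+ m) = Num.truncn (r' * 2 ^+ m).
Proof.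
move=> r01 r'01; elim: m => [_|m ih rr'].
  by rewrite !expr0 !mulr1 !(@truncn_def _ _ 0).
have := rr' m (ltnSn m); rewrite /bit => odd_eq.
have pow_ge0 s : 0 <= s < 1 -> 0 <= s * 2 ^+ m.
  by case/andP => s0 _; rewrite mulr_ge0 ?exprn_ge0.
rewrite -[LHS]odd_double_half -[RHS]odd_double_half odd_eq.
congr (_ + _.*2)%N; rewrite !exprSr !mulrA !truncn_half ?pow_ge0//.
by apply: ih => k km; apply: rr'; exact: ltnW.
Qed.

Lemma truncn_eq_dist m r r' : 0 <= r -> 0 <= r' ->
  Num.truncn (r * 2 ^+ m) = Num.truncn (r' * 2 ^+ m) -> `|r - r'| <= 2 ^- m.
Proof.
move=> r0 r'0 e; have p0 : 0 < 2 ^+ m :> R by rewrite exprn_gt0.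
have := truncn_itv (mulr_ge0 r0 (ltW p0)).
have := truncn_itv (mulr_ge0 r'0 (ltW p0)).
rewrite e -natr1 => /andP[h1 h2] /andP[h3 h4].
rewrite -(@ler_pM2r _ (2 ^+ m))// mulVf ?gt_eqF// -[X in _ * X <= _](gtr0_norm p0)
    -normrM mulrBl.
by rewrite ler_norml; apply/andP; split; lra.
Qed.

Lemma first_bit_diff r r' : 0 <= r < 1 -> 0 <= r' < 1 -> r != r' ->
  exists k, [/\ bit r k != bit r' k,
    forall j, (j < k)%N -> bit r j = bit r' j & `|r - r'| <= 2 ^- k].
Proof.
move=> r01 r'01 rr'.
have dist m : (forall k, (k < m)%N -> bit r k = bit r' k) -> `|r - r'| <= 2 ^- m.
  move=> h; apply: truncn_eq_dist; first by case/andP: r01.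
    by case/andP: r'01.
  exact: bits_eq_truncn.
have ex : exists k, bit r k != bit r' k.
  apply: contrapT => nex; have agree k : bit r k = bit r' k.
    by apply/eqP/negPn/negP => h; apply: nex; exists k.
  have d0 : 0 < `|r - r'| by rewrite normr_gt0 subr_eq0.
  have [m md] := ltr_add_invr d0.
  have := dist m (fun k _ => agree k); rewrite leNgt => /negP; apply.
  rewrite add0r in md; apply: le_lt_trans md.
  by rewrite lef_pV2 ?posrE ?exprn_gt0// -natrX ler_nat ltn_expl.
exists (ex_minn ex); case: ex_minnP => k kd kmin.
have agree j : (j < k)%N -> bit r j = bit r' j.
  by move=> jk; apply/eqP/negPn/negP => /kmin; rewrite leqNgt jk.
by split=> //; exact: dist.
Qed.

End binary_digits.

Section weighted_sum.
Context {R : realType}.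
Implicit Types (h T c : nat -> R) (n k : nat).

(** A supremum of partial sums stands for the series: the terms are nonnegative in all uses, and
    two-sided bounds follow from a tail bound [T] without any limit. *)
Definition wsum h c : R := sup (range (fun n => \sum_(k < n) h k * c k)).

Section tail.
Variables (h T : nat -> R).
Hypothesis h0 : forall k, 0 <= h k.
Hypothesis T0 : forall k, 0 <= T k.
Hypothesis hT : forall k, h k + T k.+1 <= T k.

Section one.
Variable c : nat -> R.
Hypothesis c01 : forall k, 0 <= c k <= 1.

Let hc0 k : 0 <= h k * c k.
Proof. by have /andP[? _] := c01 k; rewrite mulr_ge0. Qed.

(** By telescoping, [hT] makes [T n] a bound for the sum of the [h k] with [n <= k]. *)
Let partial_le m n : \sum_(k < m) h k * c k <= \sum_(k < n) h k * c k + T n.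
Proof.
have [mn|nm] := leqP m n.
  rewrite -(subnKC mn) (big_ord_widen_cond _ (fun _ => true) (fun k => h k * c k)
      (leq_addr (n - m) m)).
  by rewrite -[leLHS]addr0; apply: lerD => //;
      rewrite [leRHS](bigID (fun i : 'I_(m + (n - m)) => (i < m)%N))/= lerDl sumr_ge0.
suff : forall j, \sum_(k < j + n) h k * c k + T (j + n)%N <= \sum_(k < n) h k * c k + T n.
  by move=> /(_ (m - n)%N); rewrite subnK ?(ltnW nm)//; apply: le_trans; rewrite lerDl.
elim=> [//|j ih]; rewrite addSn big_ord_recr/= (le_trans _ ih)// -addrA lerD2l.
apply: le_trans (hT _); rewrite lerD2r ler_piMr//.
by have /andP[] := c01 (j + n).
Qed.

Let has_sup_partial : has_sup (range (fun n => \sum_(k < n) h k * c k)).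
Proof.
split; first by exists (\sum_(k < 0) h k * c k), 0%N.
by exists (\sum_(k < 0) h k * c k + T 0) => _ [n _ <-].
Qed.

Lemma wsum_ge n : \sum_(k < n) h k * c k <= wsum h c.
Proof. by apply: sup_upper_bound => //; exists n. Qed.

Lemma wsum_le n : wsum h c <= \sum_(k < n) h k * c k + T n.
Proof.
by apply: ge_sup => [|_ [m _ <-]//]; exists (\sum_(k < 0) h k * c k), 0%N.
Qed.

End one.

Section two.
Variables c c' : nat -> R.
Hypothesis c01 : forall k, 0 <= c k <= 1.
Hypothesis c'01 : forall k, 0 <= c' k <= 1.

Lemma wsum_near n : (forall k, (k < n)%N -> c k = c' k) ->
  `|wsum h c - wsum h c'| <= T n.
Proof.
move=> cc'; have e : \sum_(k < n) h k * c k = \sum_(k < n) h k * c' k.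
  by apply: eq_bigr => k _; rewrite cc'.
have := wsum_ge c01 n; have := wsum_le c01 n.
have := wsum_ge c'01 n; have := wsum_le c'01 n.
by rewrite e ler_norml => *; apply/andP; split; lra.
Qed.

Lemma wsum_gap n : (forall k, (k < n)%N -> c k = c' k) -> c n = 1 -> c' n = 0 ->
  h n - T n.+1 <= wsum h c - wsum h c'.
Proof.
move=> cc' cn c'n; have e : \sum_(k < n) h k * c k = \sum_(k < n) h k * c' k.
  by apply: eq_bigr => k _; rewrite cc'.
have := wsum_ge c01 n.+1; have := wsum_le c'01 n.+1.
by rewrite !big_ord_recr/= e cn c'n mulr0 mulr1 addr0; lra.
Qed.

End two.

Definition bitR (r : R) k : R := (bit r k)%:R.

Lemma bitR01 r k : 0 <= bitR r k <= 1.
Proof. by rewrite /bitR; case: bit; rewrite /= ?lexx ?ler01. Qed.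

Lemma wsum_bit_gap r r' n : (forall k, (k < n)%N -> bit r k = bit r' k) ->
  bit r n != bit r' n -> h n - T n.+1 <= `|wsum h (bitR r) - wsum h (bitR r')|.
Proof.
move=> rr'; have e k : (k < n)%N -> bitR r k = bitR r' k.
  by move=> /rr'; rewrite /bitR => ->.
case rn : (bit r n); case r'n : (bit r' n) => // _.
  rewrite (le_trans _ (ler_norm _))//; apply: wsum_gap => //; rewrite ?/bitR ?rn ?r'n//;
      exact: bitR01.
rewrite distrC (le_trans _ (ler_norm _))//; apply: wsum_gap => //;
    rewrite ?/bitR ?rn ?r'n//.
- exact: bitR01.
- exact: bitR01.
- by move=> k /rr'; rewrite /bitR => ->.
Qed.

End tail.
End weighted_sum.

Section digit_cells.
Context {R : realType}.

(** The covers of dusts are indexed by the finite type of words; the representative provides a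
    centre for the cell of parameters whose digits start with [w]. *)
Definition cell_rep m (w : {ffun 'I_m -> bool}) : R :=
  xget 0 [set r | 0 <= r < 1 /\ forall k : 'I_m, bit r k = w k].

Lemma cell_repP m (r : R) : 0 <= r < 1 ->
  exists w : {ffun 'I_m -> bool}, forall k, (k < m)%N -> bit r k = bit (cell_rep w) k.
Proof.
move=> r01; exists [ffun k : 'I_m => bit r k] => k km.
have [_ /(_ (Ordinal km))/= ->] : [set s : R | 0 <= s < 1 /\
    forall j : 'I_m, bit s j = [ffun k : 'I_m => bit r k] j]
    (cell_rep [ffun k : 'I_m => bit r k]).
  by apply: xgetPex; exists r; split=> // j; rewrite ffunE.
by rewrite ffunE.
Qed.

End digit_cells.

Section dust.
Context {R : realType}.
Implicit Types (i : bool) (k n : nat) (r : R).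
Variables (delta : nat -> R) (theta : R).

Definition mask i k : R := if odd k == i then delta k else 0.

(** The sum of a geometric series of ratio [theta]: the first rank from [k] on with parity [i] is
    [k + (odd k != i)], and [delta] decays by [theta] every two ranks. *)
Definition mask_tail i k : R := (1 - theta)^-1 * delta (k + (odd k != i)).

(* Both coordinates of the point with parameter [r] use the binary digits of
   [r]: those of even rank for the first one, those of odd rank for the other. *)
Definition coord i r : R := wsum (mask i) (bitR r).

Hypothesis theta_lt : theta < 2^-1.
Hypothesis delta0 : forall k, 0 < delta k.
Hypothesis delta_ni : forall k, delta k.+1 <= delta k.
Hypothesis delta_theta : forall k, delta k.+2 <= theta * delta k.

Let K := (1 - theta)^-1.

Let K0 : 0 < K.
Proof. by rewrite invr_gt0; have := theta_lt; lra. Qed.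

Let KE : K * (1 - theta) = 1.
Proof. by rewrite mulVf// gt_eqF//; have := theta_lt; lra. Qed.

Lemma mask_ge0 i k : 0 <= mask i k.
Proof. by rewrite /mask; case: ifP => // _; exact: ltW. Qed.

Lemma mask_tail_ge0 i k : 0 <= mask_tail i k.
Proof. by rewrite mulr_ge0// ltW. Qed.

Lemma mask_tail_step i k : mask i k + mask_tail i k.+1 <= mask_tail i k.
Proof.
rewrite /mask /mask_tail -/K oddS; case: (odd k) i => -[] //=;
    rewrite ?addn0 ?addn1 ?add0r//.
  have : K * delta k.+2 <= K * (theta * delta k) by rewrite ler_pM2l.
  have : K * (1 - theta) * delta k = delta k by rewrite KE mul1r.
  lra.
have : K * delta k.+2 <= K * (theta * delta k) by rewrite ler_pM2l.
have : K * (1 - theta) * delta k = delta k by rewrite KE mul1r.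
lra.
Qed.

Lemma mask_tail_le i k : mask_tail i k <= K * delta k.
Proof. by rewrite /mask_tail -/K ler_pM2l//; case: (_ != _); rewrite ?addn0 ?addn1. Qed.

Lemma coord_ge0 i r : 0 <= coord i r.
Proof.
have := wsum_ge (mask_ge0 i) (mask_tail_ge0 i) (mask_tail_step i) (bitR01 r) 0.
by rewrite big_ord0.
Qed.

Lemma coord_le i r : coord i r <= K * delta 0%N.
Proof.
have := wsum_le (mask_ge0 i) (mask_tail_ge0 i) (mask_tail_step i) (bitR01 r) 0.
by rewrite big_ord0 add0r => /le_trans; apply; exact: mask_tail_le.
Qed.

Lemma coord_near i r r' n : (forall k, (k < n)%N -> bit r k = bit r' k) ->
  `|coord i r - coord i r'| <= K * delta n.
Proof.
move=> rr'; apply: le_trans (mask_tail_le i n).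
apply: (wsum_near (mask_ge0 i) (mask_tail_ge0 i) (mask_tail_step i)
  (bitR01 r) (bitR01 r')).
by move=> k kn; rewrite /bitR rr'.
Qed.

(** This is [1 - theta / (1 - theta)]: the weight of the first differing digit, minus the bound on
    the tail that may oppose it, relative to that weight. It is positive because [theta] is below
    1/2. *)
Let gap := (1 - 2 * theta) / (1 - theta).

Lemma coord_gap_gt0 : 0 < gap.
Proof. by rewrite divr_gt0//; have := theta_lt; lra. Qed.

Lemma coord_gap r r' : 0 <= r < 1 -> 0 <= r' < 1 -> r != r' ->
  exists k i, `|r - r'| <= 2 ^- k /\ gap * delta k <= `|coord i r - coord i r'|.
Proof.
move=> r01 r'01 /(first_bit_diff r01 r'01)[k [kd agree rr']].
exists k, (odd k); split=> //.
apply: le_trans (wsum_bit_gap (mask_ge0 _) (mask_tail_ge0 _) (mask_tail_step (odd k))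
    agree kd).
rewrite /mask eqxx /mask_tail oddS -/K.
have -> : (~~ odd k != odd k) = true by case: odd.
rewrite addn1.
have : K * delta k.+2 <= K * (theta * delta k) by rewrite ler_pM2l.
have : K * (1 - theta) * delta k = delta k by rewrite KE mul1r.
rewrite /gap -/K; lra.
Qed.

(** If [k] is the first rank where the digits differ, the parameters are within [2 ^- k], while the
    coordinate with the parity of [k] moves by at least [gap * delta k]. This inverse Hoelder bound
    feeds the mass distribution principle, both for the set [E] and for the image. *)
Lemma coord_holder (s C : R) r r' (D : R) : 0 <= s -> 0 < C ->
  (forall k, 2 ^- k <= C * delta k `^ s) -> 0 <= r < 1 -> 0 <= r' < 1 ->
  (forall i, `|coord i r - coord i r'| <= D) ->
  `|r - r'| <= C / gap `^ s * D `^ s.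
Proof.
move=> s0 C0 deltaC r01 r'01 hD.
have gap0 := coord_gap_gt0.
have [->|rr'] := eqVneq r r'.
  by rewrite subrr normr0 mulr_ge0 ?powR_ge0// divr_ge0 ?powR_ge0// ltW.
have [k [i [rk gk]]] := coord_gap r01 r'01 rr'.
apply: (le_trans rk); apply: (le_trans (deltaC k)).
rewrite -mulrA ler_pM2l// ler_pdivlMl ?powR_gt0// -powRM ?(ltW gap0) ?(ltW (delta0 k))//.
apply: ge0_ler_powR => //; rewrite ?nnegrE.
- by rewrite mulr_ge0// ltW.
- exact: le_trans (hD i).
- exact: le_trans (hD i).
Qed.

End dust.

(** * Volume of tubes around cosets *)

Section tubes.
Context {R : realType}.
Implicit Types (x y t r e : R).

(* Tubes around the coset through [(0, y, t)]: the map
   [(x, y, t) |-> (x, y, t + 2 * x * y)] straightens the cosets. *)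
Definition tube y t r : set (heis R) :=
  [set q | [/\ `|q.1.1| <= 3, `|q.1.2 - y| <= r &
               `|q.2 + 2 * q.1.1 * q.1.2 - t| <= r]].

Let grid_index (z Z e : R) : 0 < e -> 0 <= z <= Z ->
  exists i : 'I_(Num.truncn (Z / e)).+1, 0 <= z - i%:R * e < e.
Proof.
move=> e0 /andP[z0 zZ].
have zZe : z / e <= Z / e by rewrite ler_pM2r ?invr_gt0.
have iZ : (Num.truncn (z / e) < (Num.truncn (Z / e)).+1)%N by rewrite ltnS le_truncn.
exists (Ordinal iZ) => /=.
have /andP[] := truncn_itv (divr_ge0 z0 (ltW e0)).
by rewrite ler_pdivlMr// ltr_pdivrMr// -natr1 mulrDl mul1r => h1 h2; apply/andP; split; lra.
Qed.

Let grid_size (Z e : R) : 0 < e -> 0 <= Z ->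
  (Num.truncn (Z / e)).+1%:R <= (Z + e) / e.
Proof.
move=> e0 Z0; rewrite -natr1 mulrDl divff ?gt_eqF// lerD2r truncn_le.
by rewrite divr_ge0// ltW.
Qed.

(** The left translate by [(xi, yj, 0)] of the box with sides [e], [e], [e ^+ 2] whose heights start
    at [b]; the last condition is the third coordinate of [hmul (hinv (xi, yj, 0)) q]. *)
Let cell (xi yj b e : R) : set (heis R) :=
  [set q | [/\ 0 <= q.1.1 - xi < e, 0 <= q.1.2 - yj < e &
               0 <= q.2 + 2 * yj * q.1.1 - 2 * xi * q.1.2 - b < e ^+ 2]].

Let cell_diam (xi yj b e : R) (p q : heis R) : 0 < e ->
  cell xi yj b e p -> cell xi yj b e q -> hdist p q <= 2 * e.
Proof.
move=> e0 [/andP[pu pu'] /andP[pv pv'] /andP[pw pw']]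
  [/andP[qu qu'] /andP[qv qv'] /andP[qw qw']].
apply: ltW; rewrite hdist_ltE ?mulr_gt0//.
pose u1 := p.1.1 - xi; pose u2 := q.1.1 - xi; pose v1 := p.1.2 - yj; pose v2 := q.1.2 - yj.
pose w := q.2 - p.2 + 2 * yj * (u2 - u1) - 2 * xi * (v2 - v1).
have -> : q.1.1 - p.1.1 = u2 - u1 by rewrite /u1 /u2; ring.
have -> : q.1.2 - p.1.2 = v2 - v1 by rewrite /v1 /v2; ring.
have -> : q.2 - p.2 + 2 * (p.1.2 * q.1.1 - p.1.1 * q.1.2) =
    w + 2 * (v1 * u2 - u1 * v2) by rewrite /w /u1 /u2 /v1 /v2; ring.
have hu : `|u2 - u1| <= e by rewrite ler_norml /u1 /u2; apply/andP; split; lra.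
have hv : `|v2 - v1| <= e by rewrite ler_norml /v1 /v2; apply/andP; split; lra.
have hw : `|w| <= e ^+ 2.
  by rewrite ler_norml /w /u1 /u2 /v1 /v2; apply/andP; split; lra.
have h1 : 0 <= v1 * u2 <= e ^+ 2.
  by rewrite mulr_ge0//= expr2 ler_pM// ltW.
have h2 : 0 <= u1 * v2 <= e ^+ 2.
  by rewrite mulr_ge0//= expr2 ler_pM// ltW.
have sq (z m : R) : `|z| <= m -> z ^+ 2 <= m ^+ 2.
  by move=> zm; rewrite -(real_normK (num_real z)) ler_pXn2r// nnegrE ?(le_trans _ zm).
have hN1 : ((u2 - u1) ^+ 2 + (v2 - v1) ^+ 2) ^+ 2 <= (2 * e ^+ 2) ^+ 2.
  apply: (sq); rewrite ger0_norm ?addr_ge0 ?sqr_ge0//.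
  by have := sq _ _ hu; have := sq _ _ hv; lra.
have hN2 : (w + 2 * (v1 * u2 - u1 * v2)) ^+ 2 <= (3 * e ^+ 2) ^+ 2.
  apply: (sq); move: hw h1 h2; rewrite !ler_norml => /andP[? ?] /andP[? ?] /andP[? ?].
  by apply/andP; split; lra.
(* The two squares add up to [13 * e ^+ 4], which is below [(2 * e) ^+ 4]. *)
apply: le_lt_trans (lerD hN1 hN2) _.
have e4 : 0 < e ^+ 4 by rewrite exprn_gt0.
lra.
Qed.

Lemma heis_measure_tube : exists2 C : R, 0 <= C &
  forall y t r, 0 < r -> (heis_measure (tube y t r) <= (C * r ^+ 2)%:E)%E.
Proof.
(* The constant is [7 * 3 * 31 * 16]: at most [7 / e], [3 * r / e] and [31 * r / e ^+ 2] cells in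
   the three directions, each contributing [(2 * e) ^ 4]. *)
exists 10416; first exact: ler0n.
move=> y t r r0; apply: hausdorff_measure_le_cover => //; first exact: hdist_ge0.
move=> e0 e00.
pose e := Num.min (e0 / 2) (Num.min r 1).
have e_gt0 : 0 < e by rewrite !lt_min r0 ltr01 divr_gt0.
have e2 : 2 * e <= e0.
  have : e <= e0 / 2 by rewrite ge_min lexx.
  lra.
have er : e <= r by rewrite !ge_min lexx orbT.
have e1 : e <= 1 by rewrite !ge_min lexx !orbT.
have esq : 0 < e ^+ 2 by rewrite exprn_gt0.
have esqe : e ^+ 2 <= e by rewrite expr2 ger_pMr.
pose Nx := (Num.truncn (6 / e)).+1; pose Ny := (Num.truncn (2 * r / e)).+1.
(* Relative to [(xi, yj, 0)], the heights of the tube stay within [r + 12 * e + 2 * e <= 15 * r] of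
   [t - 2 * xi * yj], the two terms in [e] coming from the shear across a cell. *)
pose Nk := (Num.truncn (30 * r / e ^+ 2)).+1.
pose xi (i : 'I_Nx) : R := - 3 + i%:R * e.
pose yj (j : 'I_Ny) : R := y - r + j%:R * e.
pose b i j (k : 'I_Nk) : R := t - 2 * xi i * yj j - 15 * r + k%:R * e ^+ 2.
exists ('I_Nx * 'I_Ny * 'I_Nk)%type,
  (fun c => cell (xi c.1.1) (yj c.1.2) (b c.1.1 c.1.2 c.2) e), (2 * e).
split.
- by rewrite e2 mulr_ge0// ltW.
- move=> q [qx qy qt].
  move: qx qy; rewrite !ler_norml => /andP[qx1 qx2] /andP[qy1 qy2].
  have x06 : 0 <= q.1.1 + 3 <= 6 by apply/andP; split; lra.
  have y0r : 0 <= q.1.2 - (y - r) <= 2 * r by apply/andP; split; lra.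
  have [i /andP[i1 i2]] := grid_index e_gt0 x06.
  have [j /andP[j1 j2]] := grid_index e_gt0 y0r.
  have u0 : 0 <= q.1.1 - xi i < e by rewrite /xi; apply/andP; split; lra.
  have v0 : 0 <= q.1.2 - yj j < e by rewrite /yj; apply/andP; split; lra.
  have ie0 : 0 <= i%:R * e by rewrite mulr_ge0// ltW.
  have xi3 : `|xi i| <= 3 by rewrite ler_norml /xi; apply/andP; split; lra.
  pose sg := q.2 + 2 * yj j * q.1.1 - 2 * xi i * q.1.2 - (t - 2 * xi i * yj j - 15 * r).
  have sgE : sg = (q.2 + 2 * q.1.1 * q.1.2 - t) - 4 * (xi i * (q.1.2 - yj j))
      - 2 * ((q.1.1 - xi i) * (q.1.2 - yj j)) + 15 * r.
    by rewrite /sg; ring.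
  have c1 : `|xi i * (q.1.2 - yj j)| <= 3 * e.
    case/andP: v0 => v0 v1.
    by rewrite normrM ler_pM// ger0_norm// ltW.
  have c2 : `|(q.1.1 - xi i) * (q.1.2 - yj j)| <= e * 1.
    case/andP: v0 => v0 v1; case/andP: u0 => u0 u1.
    by rewrite normrM ler_pM// ger0_norm// ltW// (lt_le_trans v1).
  have sg01 : 0 <= sg <= 30 * r.
    move: c1 c2 qt; rewrite sgE !ler_norml => /andP[? ?] /andP[? ?] /andP[? ?].
    by apply/andP; split; lra.
  have [k /andP[k1 k2]] := grid_index esq sg01.
  exists (i, j, k) => //=; split=> //=.
  by move: k1 k2; rewrite /b /sg => k1 k2; apply/andP; split; lra.
- by move=> c p q; exact: cell_diam.
rewrite !card_prod !card_ord !natrM.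
have -> : (2 * e) `^ 4 = 16 * e ^+ 4.
  by rewrite -[4]/(4%:R) powR_mulrn ?mulr_ge0 ?(ltW e_gt0)// exprMn; ring.
have hx : Nx%:R <= 7 / e.
  apply: (le_trans (grid_size e_gt0 _)); first by lra.
  by rewrite ler_pM2r ?invr_gt0//; lra.
have hy : Ny%:R <= 3 * r / e.
  apply: (le_trans (grid_size e_gt0 _)); first by lra.
  by rewrite ler_pM2r ?invr_gt0//; lra.
have hk : Nk%:R <= 31 * r / e ^+ 2.
  apply: (le_trans (grid_size esq _)); first by lra.
  by rewrite ler_pM2r ?invr_gt0//; lra.
have e4 : 0 < 16 * e ^+ 4 by rewrite mulr_gt0// exprn_gt0.
have N0 n : 0 <= n%:R :> R by rewrite ler0n.
apply: (@le_trans _ _ (7 / e * (3 * r / e) * (31 * r / e ^+ 2) * (16 * e ^+ 4))).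
  rewrite ler_pM2r// ler_pM// ?mulr_ge0//.
  by rewrite ler_pM.
suff -> : 7 / e * (3 * r / e) * (31 * r / e ^+ 2) * (16 * e ^+ 4) = 10416 * r ^+ 2 by [].
by field; rewrite gt_eqF.
Qed.

End tubes.

(** * The set [E] and its Euclidean Hausdorff measure *)

Section cantor_dust.
Context {R : realType}.
Variable s : R.
Hypothesis s02 : 0 < s < 2.

Let s0 : 0 < s. Proof. by case/andP: s02. Qed.

Definition ratio : R := 2 `^ (- s^-1).

Definition level k : R := ratio ^+ k.

Lemma ratio_gt0 : 0 < ratio.
Proof. by rewrite powR_gt0. Qed.

Lemma ratio_powR : ratio `^ s = 2^-1.
Proof. by rewrite -powRrM mulNr mulVf ?gt_eqF// powR_inv1. Qed.

Lemma ratio_lt1 : ratio < 1.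
Proof.
rewrite ltNge; apply/negP => r1; have := ratio_powR.
have : 1 `^ s <= ratio `^ s by apply: ge0_ler_powR;
    rewrite ?nnegrE ?(ltW s0)// ltW// ratio_gt0.
rewrite powR1; lra.
Qed.

(** Splitting the exponent as [2 = s + (2 - s)] gives half of [ratio ^ (2 - s)], and [s < 2] makes
    the latter less than 1. *)
Lemma ratio_sqr_lt : ratio ^+ 2 < 2^-1.
Proof.
have r0 := ratio_gt0; rewrite -powR_mulrn ?(ltW r0)//.
have -> : ratio `^ 2%:R = ratio `^ (s + (2 - s)) by congr (_ `^ _); ring.
rewrite powRD; last by rewrite (gt_eqF r0) implybT.
rewrite ratio_powR gtr_pMr ?invr_gt0// -[ltRHS](_ : 1 `^ (2 - s) = _);
    last by rewrite powR1.
apply: gt0_ltr_powR; rewrite ?nnegrE ?(ltW r0) ?ler01 ?ratio_lt1//.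
by case/andP: s02; lra.
Qed.

Lemma level_powR k : level k `^ s = 2 ^- k.
Proof.
rewrite /level -powR_mulrn ?powR_ge0// powRAC ratio_powR powR_mulrn ?invr_ge0//.
by rewrite exprVn.
Qed.

Lemma level_gt0 k : 0 < level k.
Proof. by rewrite exprn_gt0// ratio_gt0. Qed.

Lemma level_ni k : level k.+1 <= level k.
Proof. by rewrite /level exprS ger_pMl ?level_gt0// ltW// ratio_lt1. Qed.

Lemma level_step k : level k.+2 <= ratio ^+ 2 * level k.
Proof. by rewrite /level -exprD. Qed.

Lemma level_small (e : R) : 0 < e -> exists m, level m <= e.
Proof.
move=> /ltr_add_invr[j]; rewrite add0r => je; exists (2 * j)%N.
apply: le_trans (ltW je); apply: (@le_trans _ _ (2^-1 ^+ j)).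
  by rewrite /level exprM lerXn2r ?nnegrE ?sqr_ge0 ?invr_ge0// ltW// ratio_sqr_lt.
by rewrite exprVn lef_pV2 ?posrE ?exprn_gt0// -natrX ler_nat ltn_expl.
Qed.

Definition dust_pt (r : R) : heis R := (0, coord level false r, coord level true r).

(** The closure supplies the points coded by expansions ending in ones, which the parameters in [0,
    1[ do not produce. *)
Definition dust_set : set (heis R) := closure (dust_pt @` `[0, 1[).

Let K := (1 - ratio ^+ 2)^-1.

Let K_gt0 : 0 < K.
Proof. by rewrite invr_gt0; have := ratio_sqr_lt; lra. Qed.

Lemma dust_set_near q e : dust_set q -> 0 < e -> exists r, [/\ 0 <= r < 1,
  `|q.1.1| < e, `|q.1.2 - coord level false r| < e & `|q.2 - coord level true r| < e].
Proof.
move=> Eq e0; have [_ [[r r01 <-] [[/= h1 h2] h3]]] := Eq _ (nbhsx_ballx q e e0).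
by exists r; split=> //; move: h1; rewrite /ball/= subr0.
Qed.

Lemma dust_ptP r : 0 <= r < 1 -> dust_set (dust_pt r).
Proof. by move=> r01; apply: subset_closure; exists r. Qed.

Lemma dust_set_x0 q : dust_set q -> q.1.1 = 0.
Proof.
move=> Eq; apply/eqP; rewrite -normr_le0; apply/ler_addgt0Pr => e e0.
by have [r [_ /ltW h _ _]] := dust_set_near Eq e0; rewrite add0r.
Qed.

Lemma dust_set_Vx_perp : dust_set `<=` Vx_perp.
Proof.
by move=> [[x y] t] /dust_set_x0/= ->; exists (y, t).
Qed.

Lemma dust_set_cell m q : dust_set q -> exists w : {ffun 'I_m -> bool},
  `|q.1.2 - coord level false (cell_rep w)| <= 2 * K * level m /\
  `|q.2 - coord level true (cell_rep w)| <= 2 * K * level m.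
Proof.
move=> Eq; have e0 : 0 < K * level m by rewrite mulr_gt0// level_gt0.
have [r [r01 _ h1 h2]] := dust_set_near Eq e0.
have [w rw] := cell_repP m r01; exists w.
have near i := coord_near ratio_sqr_lt level_gt0 level_ni level_step i rw.
have tri (a b c : R) : `|a - b| < K * level m -> `|b - c| <= K * level m ->
    `|a - c| <= 2 * K * level m.
  move=> ab bc; rewrite (_ : a - c = (a - b) + (b - c)); last by ring.
  by apply: le_trans (ler_normD _ _) _; lra.
by split; [apply: tri h1 (near _)|apply: tri h2 (near _)].
Qed.

Lemma dust_set_compact : compact dust_set.
Proof.
pose M : R := 2 * K.
have cpt : compact ((`[-1, 1] `*` `[-1 - M, 1 + M] `*` `[-1 - M, 1 + M]) : set (heis R)).
  by apply: compact_setX; [apply: compact_setX|]; exact: segment_compact.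
apply: subclosed_compact cpt _; first exact: closed_closure.
move=> q /(dust_set_near)/(_ ltr01)[r [r01 h1 h2 h3]].
have l0 : level 0 = 1 by rewrite /level expr0.
have hc i := coord_le ratio_sqr_lt level_gt0 level_ni level_step i r.
have hg i := coord_ge0 ratio_sqr_lt level_gt0 level_step i r.
move: h1 h2 h3 (hc false) (hc true) (hg false) (hg true) K_gt0.
rewrite l0 mulr1 -/K !ltr_norml => /andP[? ?] /andP[? ?] /andP[? ?] *.
by split; [split|]; rewrite /= in_itv/= /M; apply/andP; split; lra.
Qed.

Lemma edist3_ge0 (u v : heis R) : 0 <= edist3 u v.
Proof. exact: sqrtr_ge0. Qed.

(** The [2 ^ m] cells of rank [m] have diameter at most [8 * K * level m], and
    [level m ^ s = 2 ^- m], so the sums of the covers equal [(8 * K) ^ s] at every rank. *)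
Lemma dust_set_measure_lt_pinfty : (hausdorff_measure edist3 s dust_set < +oo)%E.
Proof.
apply: (@le_lt_trans _ _ ((8 * K) `^ s)%:E); last exact: ltry.
apply: hausdorff_measure_le_cover; [exact: edist3_ge0|exact: ltW|].
move=> e e0.
have [m me] : exists m, 8 * K * level m <= e.
  have c0 : 0 < e / (8 * K) by rewrite divr_gt0// mulr_gt0.
  have [m me] := level_small c0; exists m.
  by rewrite mulrC -ler_pdivlMr ?mulr_gt0//.
exists {ffun 'I_m -> bool}, (fun w => [set q | [/\ q.1.1 = 0,
  `|q.1.2 - coord level false (cell_rep w)| <= 2 * K * level m &
  `|q.2 - coord level true (cell_rep w)| <= 2 * K * level m]]), (8 * K * level m).
have Km : 0 < K * level m by rewrite mulr_gt0// level_gt0.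
split.
- by rewrite me andbT; lra.
- move=> q Eq; have [w [h1 h2]] := dust_set_cell m Eq.
  by exists w => //; split=> //; exact: dust_set_x0.
- move=> w p q [p1 p2 p3] [q1 q2 q3].
  rewrite /edist3 p1 q1 subrr expr0n/= add0r.
  rewrite -(@ler_pXn2r _ 2)// ?nnegrE ?sqrtr_ge0//; last by lra.
  rewrite sqr_sqrtr ?addr_ge0 ?sqr_ge0//.
  have sq (a b c : R) : `|a - c| <= 2 * K * level m -> `|b - c| <= 2 * K * level m ->
      (a - b) ^+ 2 <= (4 * K * level m) ^+ 2.
    move=> ac bc; rewrite -(real_normK (num_real (a - b))) ler_pXn2r// ?nnegrE//;
        last by lra.
    move: ac bc; rewrite !ler_norml => /andP[? ?] /andP[? ?]; apply/andP; split; lra.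
  have := sq _ _ _ p2 q2; have := sq _ _ _ p3 q3; rewrite !exprMn.
  have : 0 <= K ^+ 2 * level m ^+ 2 by rewrite mulr_ge0 ?sqr_ge0.
  lra.
rewrite card_ffun card_bool card_ord powRM ?level_powR;
    [|by rewrite mulr_ge0// ltW|exact: ltW (level_gt0 _)].
by rewrite mulrC natrX divfK ?gt_eqF ?exprn_gt0.
Qed.

Lemma dust_set_measure_gt0 : (0 < hausdorff_measure edist3 s dust_set)%E.
Proof.
pose C := 1 / ((1 - 2 * ratio ^+ 2) / (1 - ratio ^+ 2)) `^ s.
have gap0 := coord_gap_gt0 ratio_sqr_lt.
apply: (@hausdorff_measure_holder_gt0 _ _ _ edist3_ge0 s C dust_pt).
- exact: ltW.
- by rewrite divr_gt0// powR_gt0.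
- by move=> _ [r r01 <-]; apply: dust_ptP; move: r01; rewrite /= in_itv.
move=> r r'; rewrite !in_itv/= => r01 r'01.
apply: (coord_holder ratio_sqr_lt level_gt0 level_step) => //; first exact: ltW.
  by move=> k; rewrite level_powR mul1r.
move=> i; rewrite -sqrtr_sqr /edist3 /= ler_wsqrtr//.
by case: i; rewrite subrr expr0n/= add0r ?lerDl ?lerDr sqr_ge0.
Qed.

End cantor_dust.

(** * Tent functions and the Cantor set of times *)

Section bump_functions.
Context {R : realType} {V : normedModType R}.
Implicit Types (A : set V) (w : R) (q a : V).

Definition infdist A q : R := inf [set `|q - a| | a in A].

Definition bump A w q : R := Num.max 0 (1 - infdist A q / w).

Section nonempty.
Variable A : set V.
Hypothesis A0 : A !=set0.

Let has_inf_dist q : has_inf [set `|q - a| | a in A].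
Proof.
have [a Aa] := A0; split; first by exists `|q - a|, a.
by exists 0 => _ [b _ <-].
Qed.

Lemma infdist_le q a : A a -> infdist A q <= `|q - a|.
Proof. by move=> Aa; apply: ge_inf; [exact: (has_inf_dist q).2|exists a]. Qed.

Lemma infdist_ge q (e : R) : (forall a, A a -> e <= `|q - a|) -> e <= infdist A q.
Proof.
move=> h; apply: lb_le_inf; first exact: (has_inf_dist q).1.
by move=> _ [a Aa <-]; exact: h.
Qed.

Lemma infdist_ge0 q : 0 <= infdist A q.
Proof. exact: infdist_ge. Qed.

Lemma infdist_lt q (e : R) : infdist A q < e -> exists2 a, A a & `|q - a| < e.
Proof.
move=> qe; apply: contrapT => nex; move: qe; rewrite ltNge => /negP; apply.
by apply: infdist_ge => a Aa; rewrite leNgt; apply/negP => qa; apply: nex; exists a.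
Qed.

Let infdist_near q q' : infdist A q <= infdist A q' + `|q - q'|.
Proof.
rewrite -lerBlDr; apply: infdist_ge => a Aa; rewrite lerBlDr.
apply: le_trans (infdist_le _ Aa) _.
by rewrite (_ : q - a = (q' - a) + (q - q')) ?ler_normD// (addrC (q' - a)) subrKA.
Qed.

Variable w : R.
Hypothesis w0 : 0 < w.

Lemma bump_ge0 q : 0 <= bump A w q.
Proof. by rewrite /bump le_max lexx. Qed.

Lemma bump_le1 q : bump A w q <= 1.
Proof. by rewrite /bump ge_max ler01 gerBl divr_ge0 ?infdist_ge0// ltW. Qed.

Lemma bump_lipschitz q q' : `|bump A w q - bump A w q'| <= `|q - q'| / w.
Proof.
have h1 := infdist_near q q'; have h2 := infdist_near q' q.
rewrite distrC in h2.
have h3 : infdist A q / w <= infdist A q' / w + `|q - q'| / w.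
  by rewrite -mulrDl ler_pM2r ?invr_gt0.
have h4 : infdist A q' / w <= infdist A q / w + `|q - q'| / w.
  by rewrite -mulrDl ler_pM2r ?invr_gt0.
rewrite /bump ler_norml; move: (infdist A q / w) (infdist A q' / w) (`|q - q'| / w) h3 h4.
by move=> x y z; case: (leP 0 (1 - x)) => ?; case: (leP 0 (1 - y)) => ? ? ?;
  apply/andP; split; lra.
Qed.

Lemma bump_neq0 q : bump A w q != 0 -> exists2 a, A a & `|q - a| < w.
Proof.
move=> bq; apply: infdist_lt; rewrite ltNge; apply: contra bq => wq.
by rewrite /bump max_l// subr_le0 ler_pdivlMr// mul1r.
Qed.

Lemma bump_eq0 q : (forall a, A a -> w <= `|q - a|) -> bump A w q = 0.
Proof.
by move=> h; rewrite /bump max_l// subr_le0 ler_pdivlMr// mul1r infdist_ge.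
Qed.

(** Points in the closure of [A] suffice; this matters because [E] is itself a closure of coded
    points. *)
Lemma bump_eq1 q : (forall e, 0 < e -> exists2 a, A a & `|q - a| < e) -> bump A w q = 1.
Proof.
move=> h; have -> : bump A w q = Num.max 0 (1 - 0 / w).
  congr (Num.max 0 (1 - _ / w)); apply/eqP; rewrite eq_le infdist_ge0 andbT.
  apply/ler_addgt0Pr => e /h[a Aa qa]; rewrite add0r.
  exact: le_trans (infdist_le q Aa) (ltW qa).
by rewrite mul0r subr0 max_r.
Qed.

End nonempty.
End bump_functions.

Section time_scale.
Context {R : realType}.
Implicit Types (k n : nat) (r : R).

Definition kap k : R := (k.+1 * k.+2)%:R^-1.

(** The factor [1 + k.+1%:R^-1] decreases by exactly [kap k], so a tail exceeds two copies of the
    next one by [gap k]. The [2 ^ k] gaps of rank [k] have total length [kap k], and these lengths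
    telescope to at most 1. *)
Definition time_tail k : R := 2 ^- k * (1 + k.+1%:R^-1).

Definition time_weight k : R := time_tail k - time_tail k.+1.

Definition gap k : R := 2 ^- k * kap k.

Definition time r : R := wsum time_weight (bitR r).

Lemma kapE k : kap k = k.+1%:R^-1 - k.+2%:R^-1.
Proof.
have h1 : k.+1%:R != 0 :> R by rewrite pnatr_eq0.
have h2 : k.+1%:R + 1 != 0 :> R by rewrite natr1 pnatr_eq0.
rewrite /kap natrM -[k.+2%:R]natr1; move: (k.+1%:R) h1 h2 => x h1 h2.
by field; rewrite h1 h2.
Qed.

Lemma kap_gt0 k : 0 < kap k.
Proof. by rewrite invr_gt0 ltr0n. Qed.

Lemma kap_le1 k : kap k <= 1.
Proof. by rewrite /kap invf_le1 ?ltr0n// ler1n. Qed.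

Lemma kap_ni k : kap k.+1 <= kap k.
Proof. by rewrite /kap lef_pV2 ?posrE ?ltr0n// ler_nat leq_mul. Qed.

Lemma kap_sum n : \sum_(k < n) kap k <= 1.
Proof.
have -> : \sum_(k < n) kap k = 1 - n.+1%:R^-1.
  elim: n => [|n ih]; first by rewrite big_ord0 invr1 subrr.
  by rewrite big_ord_recr/= ih kapE addrA subrK.
by rewrite gerBl invr_ge0.
Qed.

Lemma gap_gt0 k : 0 < gap k.
Proof. by rewrite mulr_gt0 ?kap_gt0// invr_gt0 exprn_gt0. Qed.

Lemma gapE k : gap k = time_tail k - 2 * time_tail k.+1.
Proof.
rewrite /gap /time_tail kapE exprS.
have p2 : 2 ^+ k != 0 :> R by rewrite expf_neq0.
have h1 : k.+1%:R != 0 :> R by rewrite pnatr_eq0.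
have h2 : k.+2%:R != 0 :> R by rewrite pnatr_eq0.
by rewrite invfM; move: (k.+1%:R^-1) (k.+2%:R^-1) (2 ^- k) => a b c; field.
Qed.

Lemma gap_ni k : gap k.+1 <= gap k.
Proof.
apply: ler_pM; rewrite ?invr_ge0 ?exprn_ge0 ?(ltW (kap_gt0 _)) ?kap_ni//.
by rewrite lef_pV2 ?posrE ?exprn_gt0// exprS ler_peMl ?exprn_ge0// ler1n.
Qed.

Lemma gap_ni_le m n : (m <= n)%N -> gap n <= gap m.
Proof.
move=> /subnKC <-; elim: (n - m)%N => [|j ih]; first by rewrite addn0.
by rewrite addnS; apply: le_trans ih; exact: gap_ni.
Qed.

Lemma gap_le1 k : gap k <= 1.
Proof.
rewrite /gap -[leRHS]mulr1; apply: ler_pM;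
    rewrite ?kap_le1 ?(ltW (kap_gt0 _)) ?invr_ge0 ?exprn_ge0//.
by rewrite invf_le1 ?exprn_gt0// exprn_ege1// ler1n.
Qed.

Lemma time_tail_ge0 k : 0 <= time_tail k.
Proof. by rewrite mulr_ge0 ?invr_ge0 ?exprn_ge0// addr_ge0. Qed.

Lemma time_tail_step k : time_weight k + time_tail k.+1 <= time_tail k.
Proof. by rewrite subrK. Qed.

Lemma time_weight_ge0 k : 0 <= time_weight k.
Proof.
have := gap_gt0 k; have := time_tail_ge0 k.+1; rewrite gapE /time_weight; lra.
Qed.

Lemma time_bound r : 0 <= time r <= 2.
Proof.
have t0 : time_tail 0 = 2 by rewrite /time_tail expr0 invr1 mul1r.
have := wsum_ge time_weight_ge0 time_tail_ge0 time_tail_step (bitR01 r) 0.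
have := wsum_le time_weight_ge0 time_tail_ge0 time_tail_step (bitR01 r) 0.
by rewrite big_ord0 add0r t0 /time => -> ->.
Qed.

(* The first bit where [r] and [r'] differ has rank [j <= k], and contributes at
   least [gap j >= gap k]. *)
Lemma time_gap k r r' : 0 <= r < 1 -> 0 <= r' < 1 -> bit r k != bit r' k ->
  gap k <= `|time r - time r'|.
Proof.
move=> r01 r'01 kd; have rr' : r != r' by apply: contraNneq kd => ->.
have [j [jd agree _]] := first_bit_diff r01 r'01 rr'.
have jk : (j <= k)%N by rewrite leqNgt; apply: contraNN kd => /agree ->.
apply: le_trans (gap_ni_le jk) _.
apply: le_trans (wsum_bit_gap time_weight_ge0 time_tail_ge0 time_tail_step agree jd).
by rewrite gapE /time_weight; lra.
Qed.

Lemma bit_ex k : exists2 r : R, 0 <= r < 1 & bit r k.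
Proof.
exists (2 ^- k.+1).
  rewrite invr_ge0 exprn_ge0//= invf_lt1 ?exprn_gt0//.
  by rewrite exprn_egt1// ltr1n.
by rewrite /bit mulVf ?truncn1// expf_neq0.
Qed.

(** Bernoulli's inequality for [a = 2 ^ (e / 2)] bounds [k.+1%:R * b] by [a ^+ k]; squaring it
    dominates the quadratic growth of the inverse of [kap]. *)
Lemma kap_growth (e : R) : 0 < e ->
  exists2 C, 0 < C & forall k, (kap k)^-1 <= C * (2 ^+ k) `^ e.
Proof.
move=> e0; pose a : R := 2 `^ (e / 2).
have a1 : 1 < a.
  rewrite -[ltLHS](_ : 1 `^ (e / 2) = 1); last by rewrite powR1.
  by apply: gt0_ltr_powR; rewrite ?divr_gt0 ?nnegrE// ltr1n.
pose b := Num.min (a - 1) 1.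
have b0 : 0 < b by rewrite lt_min ltr01 subr_gt0 a1.
have ab : b <= a - 1 by rewrite ge_min lexx.
have b1 : b <= 1 by rewrite ge_min lexx orbT.
have bern k : k.+1%:R * b <= a ^+ k.
  elim: k => [|k ih]; first by rewrite mul1r expr0.
  rewrite exprS -natr1 mulrDl mul1r.
  have : 1 <= a ^+ k by rewrite exprn_ege1// ltW.
  have : k.+1%:R * b * 1 <= a ^+ k by rewrite mulr1.
  move: (a ^+ k) => c ? ?.
  have : (1 + b) * c <= a * c by rewrite ler_wpM2r//; lra.
  have : b * 1 <= b * c by rewrite ler_wpM2l// ltW.
  lra.
exists (2 / b ^+ 2); first by rewrite divr_gt0// exprn_gt0.
move=> k; have -> : (2 ^+ k) `^ e = (a ^+ k) ^+ 2.
  have aa : a ^+ 2 = 2 `^ e.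
    by rewrite expr2 -powRD; [rewrite -splitr|rewrite pnatr_eq0 implybT].
  by rewrite exprAC aa -[2 ^+ k]powR_mulrn// powRAC powR_mulrn ?powR_ge0.
rewrite /kap invrK mulrAC ler_pdivlMr ?exprn_gt0// natrM.
have hb : (k.+1%:R * b) ^+ 2 <= (a ^+ k) ^+ 2.
  rewrite ler_pXn2r ?nnegrE ?bern// ?mulr_ge0 ?(ltW b0)//.
  by rewrite exprn_ge0// (le_trans ler01)// ltW.
have k2 : k.+2%:R <= 2 * k.+1%:R :> R by rewrite -natrM ler_nat mul2n -addnn addSn addnS
    !ltnS leq_addl.
have kb : 0 <= k.+1%:R * b ^+ 2 by rewrite mulr_ge0// sqr_ge0.
have := ler_wpM2l kb k2; lra.
Qed.

End time_scale.

Section product_norm.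
Context {R : realType}.

Lemma heis_norm_le (q : heis R) (e : R) :
  (`|q| <= e) = [&& `|q.1.1| <= e, `|q.1.2| <= e & `|q.2| <= e].
Proof. by rewrite prod_normE ge_max prod_normE ge_max andbA. Qed.

Lemma heis_norm_lt (q : heis R) (e : R) :
  (`|q| < e) = [&& `|q.1.1| < e, `|q.1.2| < e & `|q.2| < e].
Proof. by rewrite prod_normE gt_max prod_normE gt_max andbA. Qed.

End product_norm.

Section hdist_continuity.
Context {R : realType}.
Implicit Types u : heis R -> R.

Lemma hdist_continuous u :
  (forall a (e : R), 0 < e -> exists2 eta, 0 < eta &
    forall b, hdist a b < eta -> `|u a - u b| < e) -> continuous u.
Proof.
move=> h a; apply/cvgrPdist_lt => e /(h a)[eta eta0 heta].
by apply/hdist_nbhsP; exists eta.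
Qed.

Lemma hdist_lipschitz_continuous u (L : R) :
  (forall a b, `|u a - u b| <= L * hdist a b) -> continuous u.
Proof.
move=> uL; apply: hdist_continuous => a e e0.
have L1 : 0 < `|L| + 1 by rewrite ltr_wpDl.
exists (e / (`|L| + 1)); first by rewrite divr_gt0.
move=> b; rewrite ltr_pdivlMr// => ab; apply: le_lt_trans (uL a b) _.
apply: le_lt_trans ab; rewrite mulrC ler_wpM2l ?hdist_ge0//.
by rewrite (le_trans (ler_norm _))// lerDl.
Qed.

Lemma heis_continuous_measurable u : continuous u -> measurable_fun setT u.
Proof.
move=> /continuousP cu; apply: (measurability _ (RGenOpens.measurableE R)).
move=> _ [_ [a [b ->] <-]]; rewrite setTI.
by apply: open_heis_measurable; apply: cu; exact: interval_open.
Qed.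

End hdist_continuity.

(** * The bumps [psi k] on the Heisenberg group: values, Lipschitz constants, supports *)

Section heisenberg_bumps.
Context {R : realType}.
Variable s : R.
Hypothesis s02 : 0 < s < 2.
Implicit Types (q a b : heis R) (k m : nat).

Definition straighten q : heis R := (q.1.1, q.1.2, q.2 + 2 * q.1.1 * q.1.2).

Definition bump_support k : set (heis R) :=
  [set a | exists r r', [/\ 0 <= r < 1, bit r k, 0 <= r' < 1 &
     a = (time r, coord (level s) false r', coord (level s) true r')]].

Definition psi k q : R := bump (bump_support k) (gap k) (straighten q).

Lemma bump_support_neq0 k : bump_support k !=set0.
Proof.
have [r r01 rk] := @bit_ex R k.
by exists (time r, coord (level s) false r, coord (level s) true r), r, r.
Qed.

Lemma psi01 k q : 0 <= psi k q <= 1.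
Proof.
rewrite /psi bump_ge0/=; exact: (bump_le1 (bump_support_neq0 k) (gap_gt0 k)).
Qed.

Lemma psi_neq0 k q : psi k q != 0 -> exists r r', [/\ 0 <= r < 1, 0 <= r' < 1,
  `|q.1.1 - time r| < gap k, `|q.1.2 - coord (level s) false r'| < gap k &
  `|q.2 + 2 * q.1.1 * q.1.2 - coord (level s) true r'| < gap k].
Proof.
move=> /(bump_neq0 (bump_support_neq0 k) (gap_gt0 k))[a [r [r' [r01 _ r'01 ->]]]].
by rewrite heis_norm_lt /= => /and3P[h1 h2 h3]; exists r, r'.
Qed.

Lemma psi_neq0_x k q : psi k q != 0 -> `|q.1.1| <= 3.
Proof.
move=> /psi_neq0[r [_ [_ _ h _ _]]].
have /andP[t0 t2] := time_bound r; have g1 := gap_le1 (R := R) k.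
by move: h; rewrite ltr_norml ler_norml => /andP[? ?]; apply/andP; split; lra.
Qed.

(** After straightening, the point has time [time r] and the transverse coordinates of [e]. If the
    digit is 1 it lies in the closure of the support set; if it is 0, the times alone are [gap k]
    apart. The value is thus the same on all cosets. *)
Lemma psi_coset k r e : 0 <= r < 1 -> dust_set s e ->
  psi k (hmul e (time r, 0, 0)) = bitR r k.
Proof.
move=> r01 Ee; have x0 := dust_set_x0 Ee.
have sE : straighten (hmul e (time r, 0, 0)) = (time r, e.1.2, e.2).
  case: e x0 {Ee} => [[x y] t] /= ->; rewrite /straighten /=.
  by congr (_, _, _); ring.
rewrite /psi sE /bitR; case rk : (bit r k).
  apply: bump_eq1; first exact: bump_support_neq0.
  move=> eps eps0; have [r' [r'01 _ h1 h2]] := dust_set_near Ee eps0.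
  exists (time r, coord (level s) false r', coord (level s) true r').
    by exists r, r'.
  by rewrite heis_norm_lt /= subrr normr0 eps0 h1.
apply: bump_eq0; [exact: bump_support_neq0|exact: gap_gt0|].
move=> _ [r1 [r' [r101 r1k _ ->]]]; have : gap k <= `|time r - time r1|.
  by apply: time_gap => //; rewrite rk r1k.
move=> /le_trans; apply.
by have := lexx `|(time r, e.1.2, e.2) - (time r1, coord (level s) false r', coord (level
    s) true r')|; rewrite {1}heis_norm_le => /and3P[].
Qed.

(** Only the third coordinate is delicate: its difference is [- w - 2 * (2 * a.1.1 + u) * v], where
    [w] is at most the squared distance, and [2 * (2 * 3 + 1) = 14] bounds the other coefficient. *)
Lemma straighten_dist a b : `|a.1.1| <= 3 -> hdist a b <= 1 ->
  `|straighten a - straighten b| <= 15 * hdist a b.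
Proof.
move=> a3; set D := hdist a b => D1.
have D0 : 0 <= D by exact: hdist_ge0.
pose u := b.1.1 - a.1.1; pose v := b.1.2 - a.1.2.
pose w := b.2 - a.2 + 2 * (a.1.2 * b.1.1 - a.1.1 * b.1.2).
have D4 : (u ^+ 2 + v ^+ 2) ^+ 2 + w ^+ 2 = D ^+ 4.
  rewrite /D hdistE -/u -/v -/w -[4%N]/(2 * 2)%N exprM !sqr_sqrtr ?sqrtr_ge0//.
  by rewrite addr_ge0 ?sqr_ge0.
have root (z m : R) n : 0 <= m -> z ^+ 2 <= m ^+ 2 -> `|z| <= m.
  by move=> m0 zm; rewrite -(ler_pXn2r (ltn0Sn 1)) ?nnegrE// real_normK ?num_real.
have uv : u ^+ 2 + v ^+ 2 <= D ^+ 2.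
  rewrite -(ler_pXn2r (ltn0Sn 1)) ?nnegrE ?addr_ge0 ?sqr_ge0//.
  by rewrite -exprM -D4 lerDl sqr_ge0.
have hu : `|u| <= D by apply: root => //; have := sqr_ge0 v; lra.
have hv : `|v| <= D by apply: root => //; have := sqr_ge0 u; lra.
have hw : `|w| <= D ^+ 2.
  apply: root; rewrite ?sqr_ge0// -exprM -D4 lerDr sqr_ge0//.
have D2 : D ^+ 2 <= D by rewrite expr2 ler_piMr.
rewrite heis_norm_le /=; apply/and3P; split.
- by rewrite distrC -/u; lra.
- by rewrite distrC -/v; lra.
have -> : a.2 + 2 * a.1.1 * a.1.2 - (b.2 + 2 * b.1.1 * b.1.2) =
    - w - 2 * (2 * a.1.1 + u) * v by rewrite /w /u /v; ring.
have h : `|2 * (2 * a.1.1 + u) * v| <= 14 * D.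
  rewrite normrM ler_pM// normrM ger0_norm// -[14]/(2 * 7)%:R natrM ler_pM2l//.
  rewrite (le_trans (ler_normD _ _))// normrM ger0_norm//; lra.
apply: le_trans (ler_normB _ _) _; rewrite normrN; lra.
Qed.

(** Straightening is controlled only for bounded [x] and distances up to 1. If one of the values is
    nonzero, its point has bounded [x]; beyond distance 1 the bound is trivial, since [psi k] takes
    values in [0, 1] and [gap k <= 1]. *)
Lemma psi_lipschitz k a b : `|psi k a - psi k b| <= 15 / gap k * hdist a b.
Proof.
have g0 := gap_gt0 (R := R) k; have g1 := gap_le1 (R := R) k.
have dist01 (x y : R) : 0 <= x <= 1 -> 0 <= y <= 1 -> `|x - y| <= 1.
  by move=> /andP[? ?] /andP[? ?]; rewrite ler_norml; apply/andP; split; lra.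
have main c d : psi k c != 0 -> `|psi k c - psi k d| <= 15 / gap k * hdist c d.
  move=> /psi_neq0_x c3; have [cd|/ltW cd] := leP (hdist c d) 1.
    apply: le_trans (bump_lipschitz (bump_support_neq0 k) g0 _ _) _.
    by rewrite mulrAC ler_pM2r ?invr_gt0// straighten_dist.
  have g15 : (1 : R) <= 15 / gap k by rewrite ler_pdivlMr// mul1r (le_trans g1)// ler1n.
  have : 1 * 1 <= 15 / gap k * hdist c d by rewrite ler_pM// ler01.
  by rewrite mulr1; apply: le_trans; apply: dist01; exact: psi01.
have [a0|a0] := eqVneq (psi k a) 0; last exact: main.
have [b0|b0] := eqVneq (psi k b) 0.
  by rewrite a0 b0 subrr normr0 mulr_ge0 ?hdist_ge0// divr_ge0// ltW.
by rewrite distrC hdist_sym; exact: main.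
Qed.

End heisenberg_bumps.

Lemma outer_measure_le_card (R : realType) (T : Type)
    (mu : {outer_measure set T -> \bar R}) (I : finType) (F : I -> set T)
    (A : set T) (B : R) :
  A `<=` \bigcup_i F i -> (forall i, (mu (F i) <= B%:E)%E) ->
  (mu A <= (#|I|%:R * B)%:E)%E.
Proof.
move=> AF FB.
pose G n := if insub n is Some i then F (@enum_val I predT i) else set0.
apply: le_trans (le_outer_measure mu _ (\big[setU/set0]_(i < #|I|) G i) _) _.
  move=> x /AF[i _ Fx]; rewrite -bigcup_mkord; exists (enum_rank i) => //=.
  rewrite /G; case: insubP => [j _ ji|]; last by rewrite ltn_ord.
  suff -> : enum_val j = i by [].
  by apply: enum_rank_inj; rewrite enum_valK; exact: val_inj.
apply: le_trans (outer_measure_subadditive mu G #|I|) _.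
rewrite mulr_natl -[in leRHS](card_ord #|I|) -sumr_const -sumEFin.
by apply: lee_sum => i _; rewrite /G valK.
Qed.

Section bump_support_measure.
Context {R : realType}.
Variable s : R.
Hypothesis s02 : 0 < s < 2.

Lemma level_between (e : R) : 0 < e <= 1 -> exists m,
  level s m.+1 < e <= level s m.
Proof.
move=> /andP[e0 e1].
have ex : exists m, level s m.+1 < e.
  have [m me] := level_small s02 (divr_gt0 e0 (ltr0n _ 2)); exists m.
  by have := level_ni s02 m; lra.
exists (ex_minn ex); case: ex_minnP => m me min; rewrite me/=.
case: m me min => [_ _|m me min]; first by rewrite /level expr0.
by rewrite leNgt; apply/negP => /min; rewrite ltnn.
Qed.

(** At the rank [m] where [level m] is comparable to [gap k], the support lies in [2 ^ m] tubes of
    radius [(K + 1) * level m]. Since [2 ^ m = level m ^ (- s)], their total volume is of order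
    [level m ^ (2 - s)]. *)
Lemma psi_support_measure : exists2 C : R, 0 <= C & forall k,
  (heis_measure [set q : heis R | psi s k q != 0%R] <= (C * gap k `^ (2 - s))%:E)%E.
Proof.
pose K : R := (1 - ratio s ^+ 2)^-1.
have K0 : 0 < K by rewrite invr_gt0; have := ratio_sqr_lt s02; lra.
have r0 : 0 < ratio s by rewrite ratio_gt0.
have [C0 C00 tubeC] := @heis_measure_tube R.
exists (C0 * (K + 1) ^+ 2 * (ratio s)^-1 `^ (2 - s)).
  by apply: mulr_ge0; [apply: mulr_ge0 => //; exact: sqr_ge0|exact: powR_ge0].
move=> k; have g0 := gap_gt0 (R := R) k.
have [|m /andP[m1 m2]] := @level_between (gap k); first by rewrite g0 gap_le1.
have l0 : 0 < level s m by rewrite level_gt0.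
pose r := (K + 1) * level s m.
have rp : 0 < r by rewrite mulr_gt0// ltr_wpDl// ltW.
apply: le_trans (@outer_measure_le_card _ _ (@heis_measure R) {ffun 'I_m -> bool}
  (fun w => tube (coord (level s) false (cell_rep w)) (coord (level s) true (cell_rep w)) r)
  _ (C0 * r ^+ 2) _ _) _.
- move=> q /= pq; have q3 := psi_neq0_x pq.
  have [_ [r' [_ r'01 _ h1 h2]]] := psi_neq0 pq.
  have [w rw] := cell_repP m r'01; exists w => //.
  have near i := coord_near (ratio_sqr_lt s02) (level_gt0 s) (level_ni s02) (level_step
      s) i rw.
  have tri (a b c : R) : `|a - b| < gap k -> `|b - c| <= K * level s m -> `|a - c| <= r.
    move=> ab bc; rewrite (_ : a - c = (a - b) + (b - c)); last by ring.
    by apply: le_trans (ler_normD _ _) _; rewrite /r; lra.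
  by split=> //; [apply: tri h1 (near _)|apply: tri h2 (near _)].
- by move=> w; exact: tubeC.
rewrite lee_fin card_ffun card_bool card_ord natrX /r exprMn.
have lE : level s m ^+ 2 = level s m `^ (2 - s) * 2 ^- m.
  rewrite -(level_powR s02) -powRD; last by rewrite (gt_eqF l0) implybT.
  by rewrite subrK powR_mulrn// ltW.
have -> : 2 ^+ m * (C0 * ((K + 1) ^+ 2 * level s m ^+ 2)) =
    C0 * (K + 1) ^+ 2 * level s m `^ (2 - s).
  have p0 : 2 ^+ m != 0 :> R by rewrite expf_neq0.
  by rewrite lE; field.
rewrite -[leRHS]mulrA ler_wpM2l ?(mulr_ge0 C00 (sqr_ge0 _))// -powRM ?invr_ge0 ?(ltW r0)
    ?(ltW g0)//.
apply: ge0_ler_powR; rewrite ?nnegrE ?(ltW l0)//.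
- by case/andP: s02; lra.
- by rewrite mulr_ge0 ?invr_ge0 ?(ltW r0) ?(ltW g0).
by rewrite ler_pdivlMl// -exprS ltW.
Qed.

End bump_support_measure.

(** * The weights of the image dust *)

Section image_weights.
Context {R : realType}.
Variable alpha : R.
Hypothesis alpha12 : 1 < alpha < 2.

Let a02 : 0 < alpha < 2. Proof. by case/andP: alpha12 => ? ?; apply/andP; split; lra. Qed.
Let a0 : 0 < alpha. Proof. by case/andP: a02. Qed.

(** Of the three factors [kap k], one pays for the division by [kap k] in the gradient, one for the
    factor [kap k] inside [gap k ^ (1 / alpha)], and one makes the energy summable. *)
Definition weight k : R := kap k ^+ 3 * level alpha k.

Lemma weight_gt0 k : 0 < weight k.
Proof. by rewrite mulr_gt0 ?level_gt0// exprn_gt0// kap_gt0. Qed.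

Let cube_ni k : kap k.+1 ^+ 3 <= kap k ^+ 3 :> R.
Proof. by apply: lerXn2r; rewrite ?nnegrE ?kap_ni ?ltW ?kap_gt0. Qed.

Lemma weight_ni k : weight k.+1 <= weight k.
Proof.
apply: ler_pM => //; rewrite ?level_ni// ltW ?level_gt0//.
by rewrite exprn_gt0// kap_gt0.
Qed.

Lemma weight_step k : weight k.+2 <= ratio alpha ^+ 2 * weight k.
Proof.
rewrite mulrCA; apply: ler_pM; rewrite ?level_step//.
- by rewrite ltW// exprn_gt0// kap_gt0.
- by rewrite ltW// level_gt0.
- exact: le_trans (cube_ni _) (cube_ni _).
Qed.

Lemma level_le1 k : level alpha k <= 1.
Proof. by rewrite exprn_ile1 ?powR_ge0// ltW// ratio_lt1. Qed.

Lemma weight_le_kap k : weight k <= kap k.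
Proof.
have k0 := kap_gt0 (R := R) k; have k1 := kap_le1 (R := R) k.
rewrite /weight -[leRHS]mulr1 ler_pM ?level_le1 ?(ltW (level_gt0 _ _))//.
  by rewrite exprn_ge0// ltW.
by rewrite exprS ger_pMr// exprn_ile1// ltW.
Qed.

Lemma kap_level_le k : kap k * level alpha k <= gap k `^ alpha^-1.
Proof.
have k0 := kap_gt0 (R := R) k; have k1 := kap_le1 (R := R) k.
rewrite /gap -(level_powR a02) powRM ?powR_ge0 ?(ltW k0)// -powRrM.
rewrite divff ?gt_eqF// powRr1 ?(ltW (level_gt0 _ _))// mulrC ler_wpM2l ?(ltW (level_gt0
    _ _))//.
apply: ger1_powR; rewrite ?k0// invf_le1//.
by case/andP: alpha12 => /ltW.
Qed.

(** A strictly smaller exponent leaves an exponential margin [2 ^ (k * eta)], which absorbs the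
    polynomial factor. *)
Lemma weight_growth (beta : R) : 0 <= beta < alpha ->
  exists2 C, 0 < C & forall k, 2 ^- k <= C * weight k `^ beta.
Proof.
move=> /andP[b0 ba]; pose eta := 1 - beta / alpha.
have eta0 : 0 < eta by rewrite subr_gt0 ltr_pdivrMr// mul1r.
(* The 6 is three factors [kap k], raised to a power [beta] that is at most 2. *)
have [C0 C00 hC] := kap_growth (divr_gt0 eta0 (ltr0n R 6)).
exists ((C0 ^+ 3) `^ beta); first by rewrite powR_gt0// exprn_gt0.
move=> k; have k0 := kap_gt0 (R := R) k; have l0 := level_gt0 alpha k.
pose P : R := 2 ^+ k; have P0 : 0 < P by rewrite exprn_gt0.
have P1 : 1 <= P by rewrite exprn_ege1// ler1n.
have levelE : level alpha k `^ beta = (P `^ (beta / alpha))^-1.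
  have {1}-> : beta = alpha * (beta / alpha) by rewrite mulrC divfK ?gt_eqF.
  rewrite powRrM level_powR// -/P -powRN -[P^-1]powR_inv1 ?(ltW P0)// -powRrM.
  by rewrite mulN1r.
have c0 : 0 <= kap k ^+ 3 :> R by rewrite exprn_ge0 ?ltW.
have C30 : 0 <= C0 ^+ 3 by rewrite exprn_ge0 ?ltW.
have -> : weight k `^ beta = (kap k ^+ 3) `^ beta * (P `^ (beta / alpha))^-1.
  by rewrite -levelE -powRM ?(ltW l0).
rewrite mulrA -powRM// -exprMn ler_pdivlMr ?powR_gt0// -/P.
have -> : P^-1 * P `^ (beta / alpha) = P `^ (- eta).
  rewrite -[P^-1]powR_inv1 ?(ltW P0)// -powRD; last by rewrite (gt_eqF P0) implybT.
  by congr (_ `^ _); rewrite /eta; ring.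
have q0 : 0 < P `^ (- (eta / 6)) by rewrite powR_gt0.
have h : P `^ (- (eta / 6)) <= C0 * kap k.
  rewrite powRN invf_ple ?posrE ?powR_gt0 ?mulr_gt0// invfM mulrC ler_pdivrMr//.
  by rewrite mulrC; exact: hC.
apply: (@le_trans _ _ ((P `^ (- (eta / 6)) ^+ 3) `^ beta)).
  rewrite -powR_mulrn ?(ltW q0)// -!powRrM; apply: ler_powR => //.
  have b2 : beta <= 2 by case/andP: alpha12 => _ /ltW; apply/le_trans/ltW.
  have := ler_wpM2l (ltW eta0) b2; lra.
apply: ge0_ler_powR; rewrite ?nnegrE ?exprn_ge0 ?mulr_ge0 ?(ltW q0) ?(ltW k0) ?(ltW C00)//.
by rewrite lerXn2r ?nnegrE ?mulr_ge0 ?(ltW q0) ?(ltW k0) ?(ltW C00).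
Qed.

End image_weights.

Section planar_distance.
Context {R : realType}.
Implicit Types u v : R * R.

Lemma edist2_ge0 u v : 0 <= edist2 u v.
Proof. exact: sqrtr_ge0. Qed.

Lemma enorm2_le u : enorm2 u <= `|u.1| + `|u.2|.
Proof.
rewrite /enorm2 -(@ler_pXn2r _ 2)// ?nnegrE ?sqrtr_ge0 ?addr_ge0//.
rewrite sqr_sqrtr ?addr_ge0 ?sqr_ge0// sqrrD !real_normK ?num_real//.
by have := mulr_ge0 (normr_ge0 u.1) (normr_ge0 u.2); lra.
Qed.

Lemma normr1_le_edist2 u v : `|u.1 - v.1| <= edist2 u v.
Proof. by rewrite -sqrtr_sqr ler_wsqrtr//= lerDl sqr_ge0. Qed.

Lemma normr2_le_edist2 u v : `|u.2 - v.2| <= edist2 u v.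
Proof. by rewrite -sqrtr_sqr ler_wsqrtr//= lerDr sqr_ge0. Qed.

End planar_distance.

Lemma rectifiable_uniform (R : realType) (gamma : R -> heis R) : rectifiable gamma ->
  {in `[0, 1], forall t (e : R), 0 < e ->
    exists2 eta, 0 < eta & {in `[0, 1], forall t',
      `|t - t'| < eta -> hdist (gamma t) (gamma t') < e}}.
Proof.
move=> [/subspace_continuousP cg _] t t01 e e0.
have tN : nbhs (gamma t) [set b | hdist (gamma t) b < e].
  by apply/hdist_nbhsP; exists e.
have /nbhs_ballP[eta /= eta0 h] := cg t t01 _ tN.
exists eta => // t' t'01 tt'; exact: h.
Qed.

Lemma continuous_enorm2 (R : realType) (T : topologicalType) (u v : T -> R) :
  continuous u -> continuous v -> continuous (fun q => enorm2 (u q, v q)).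
Proof.
move=> cu cv q; rewrite /enorm2 /=.
apply: (@cvg_comp _ _ _ (fun b => u b ^+ 2 + v b ^+ 2) Num.sqrt);
    last exact: sqrt_continuous.
by apply: cvgD; rewrite expr2; [exact: (cvgM (cu q) (cu q))|exact: (cvgM (cv q) (cv q))].
Qed.

(** * The map, its continuity and its integrability *)

Section sobolev_map.
Context {R : realType}.
Variables (s alpha : R).
Hypothesis s02 : 0 < s < 2.
Hypothesis alpha12 : 1 < alpha < 2.
Implicit Types (q a b : heis R) (i : bool) (k n : nat).

Let a02 : 0 < alpha < 2. Proof. by case/andP: alpha12 => ? ?; apply/andP; split; lra. Qed.

Let theta : R := ratio alpha ^+ 2.

Let theta_lt : theta < 2^-1. Proof. exact: ratio_sqr_lt. Qed.

Let K : R := (1 - theta)^-1.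

Let K0 : 0 < K.
Proof. by rewrite invr_gt0; have := theta_lt; lra. Qed.

Definition component i q : R := wsum (mask (weight alpha) i) (fun k => psi s k q).

Definition sobolev_map q : R * R := (component false q, component true q).

Let m0 i k : 0 <= mask (weight alpha) i k.
Proof. by apply: mask_ge0 => j; exact: weight_gt0. Qed.

Let t0 i k : 0 <= mask_tail (weight alpha) theta i k.
Proof. by apply: mask_tail_ge0 => // j; [exact: weight_gt0]. Qed.

Let step i k : mask (weight alpha) i k + mask_tail (weight alpha) theta i k.+1
  <= mask_tail (weight alpha) theta i k.
Proof.
by apply: mask_tail_step => // j; exact: weight_step.
Qed.

Let tail_le i k : mask_tail (weight alpha) theta i k <= K * kap k.
Proof.
apply: (@le_trans _ _ (K * weight alpha k)).
  by apply: mask_tail_le => // j; exact: weight_ni.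
by rewrite ler_pM2l// weight_le_kap.
Qed.

Let tail_small (e : R) : 0 < e -> exists n, forall i,
  mask_tail (weight alpha) theta i n <= e.
Proof.
move=> e0; have [n] := ltr_add_invr (divr_gt0 e0 K0); rewrite add0r => ne.
exists n => i; apply: le_trans (tail_le i n) _.
rewrite mulrC -ler_pdivlMr//; apply: le_trans (ltW ne).
by rewrite /kap lef_pV2 ?posrE ?ltr0n// ler_nat leq_pmulr.
Qed.

Lemma component_increment i n a b : `|component i a - component i b| <=
  \sum_(k < n) mask (weight alpha) i k * `|psi s k a - psi s k b| +
  mask_tail (weight alpha) theta i n.
Proof.
have near_of_partial (x y z ca cb t : R) : `|x - y| <= z -> x <= ca -> ca <= x + t ->
    y <= cb -> cb <= y + t -> `|ca - cb| <= z + t.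
  by rewrite !ler_norml => /andP[? ?] ? ? ? ?; apply/andP; split; lra.
have sum_near : `|\sum_(k < n) mask (weight alpha) i k * psi s k a -
    \sum_(k < n) mask (weight alpha) i k * psi s k b| <=
    \sum_(k < n) mask (weight alpha) i k * `|psi s k a - psi s k b|.
  rewrite -sumrB; apply: le_trans (ler_norm_sum _ _ _) _.
  by apply: ler_sum => k _; rewrite -mulrBr normrM ger0_norm.
have ha1 := wsum_ge (m0 i) (t0 i) (step i) (fun k => psi01 s k a) n.
have ha2 := wsum_le (m0 i) (t0 i) (step i) (fun k => psi01 s k a) n.
have hb1 := wsum_ge (m0 i) (t0 i) (step i) (fun k => psi01 s k b) n.
have hb2 := wsum_le (m0 i) (t0 i) (step i) (fun k => psi01 s k b) n.
exact: near_of_partial sum_near ha1 ha2 hb1 hb2.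
Qed.

(** Each rank feeds exactly one coordinate, so adding the increments of both coordinates counts
    every [weight alpha k] once; the two tails share [e]. *)
Lemma sobolev_map_increment a b (e : R) : 0 < e -> exists n,
  edist2 (sobolev_map a) (sobolev_map b) <=
  \sum_(k < n) `|weight alpha k * psi s k a - weight alpha k * psi s k b| + e.
Proof.
move=> e0; have [n hn] := tail_small (divr_gt0 e0 (ltr0n _ 2)); exists n.
apply: le_trans (enorm2_le _) _ => /=.
apply: le_trans (lerD (component_increment false n a b) (component_increment true n a b)) _.
rewrite addrACA -big_split/= [X in _ + X <= _](_ : _ = mask_tail (weight alpha) theta
    false n +
  mask_tail (weight alpha) theta true n)//.
apply: lerD; last by have := hn false; have := hn true; lra.
apply: ler_sum => k _; rewrite -mulrBr normrM (ger0_norm (ltW (weight_gt0 alpha k)))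
    -mulrDl.
by rewrite ler_wpM2r// /mask; case: odd; rewrite ?addr0 ?add0r.
Qed.

Lemma component_continuous i : continuous (component i).
Proof.
apply: hdist_continuous => a e e0.
have [n hn] := tail_small (divr_gt0 e0 (ltr0n _ 2)).
pose C : R := \sum_(k < n) mask (weight alpha) i k * (15 / gap k).
have C0 : 0 <= C.
  by apply: sumr_ge0 => k _; rewrite mulr_ge0// divr_ge0 ?ler0n// ltW// gap_gt0.
have C1 : 0 < C + 1 by rewrite ltr_wpDl.
exists (e / 2 / (C + 1)); first by rewrite !divr_gt0.
move=> b; rewrite ltr_pdivlMr// => ab.
apply: le_lt_trans (component_increment i n a b) _.
have h1 : \sum_(k < n) mask (weight alpha) i k * `|psi s k a - psi s k b| <= C * hdist a b.
  rewrite mulr_suml; apply: ler_sum => k _; rewrite -mulrA ler_wpM2l//.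
  exact: psi_lipschitz.
have h2 : C * hdist a b <= hdist a b * (C + 1).
  by rewrite mulrC ler_wpM2l ?hdist_ge0// lerDl.
have := hn i; move: h1 h2 ab; move: (\sum_(k < n) _) (C * _) (_ * (C + 1)) (mask_tail _ _
    _ _).
by move=> x y z t; lra.
Qed.

Lemma sobolev_map_continuous : continuous sobolev_map.
Proof.
by move=> q; exact: (cvg_pair (@component_continuous false q) (@component_continuous true
    q)).
Qed.

Let component_bound i q : 0 <= component i q <= K.
Proof.
have := wsum_ge (m0 i) (t0 i) (step i) (fun k => psi01 s k q) 0.
have := wsum_le (m0 i) (t0 i) (step i) (fun k => psi01 s k q) 0.
rewrite big_ord0 add0r => h1 h2; apply/andP; split; first exact: h2.
apply: le_trans h1 (le_trans (tail_le i 0) _).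
by rewrite ger_pMr// kap_le1.
Qed.

Let component_eq0 i q : (forall k, psi s k q = 0) -> component i q = 0.
Proof.
move=> q0; have sum0 n : \sum_(k < n) mask (weight alpha) i k * psi s k q = 0.
  by rewrite big1// => k _; rewrite q0 mulr0.
have [h _] := andP (component_bound i q).
apply/eqP; rewrite eq_le h andbT; apply/ler_addgt0Pr => e /tail_small[n hn].
apply: le_trans (wsum_le (m0 i) (t0 i) (step i) (fun k => psi01 s k q) n) _.
by rewrite sum0 lerD2l.
Qed.

Lemma psi_continuous k : continuous (psi s k).
Proof. by apply: hdist_lipschitz_continuous => a b; exact: psi_lipschitz. Qed.

Lemma psi_support_measurable k : measurable [set q | psi s k q != 0].
Proof.
have -> : [set q | psi s k q != 0] = psi s k @^-1` (~` [set 0]).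
  by apply/seteqP; split => q /= /eqP.
rewrite -[X in measurable X]setTI.
apply: heis_continuous_measurable (@psi_continuous k) _ _ _ => //.
by apply: measurableC; exact: measurable_set1.
Qed.

(** The map is bounded, and it vanishes off the union of the supports, which lies in a single tube
    of finite measure. *)
Lemma sobolev_map_integrable (p : R) : 0 < p ->
  heis_measure.-integrable setT (fun q => (enorm2 (sobolev_map q) `^ p)%:E).
Proof.
move=> p0; apply/integrableP.
have mf : measurable_fun setT (fun q => (enorm2 (sobolev_map q) `^ p)%:E).
  apply/measurable_EFinP; apply: (measurableT_comp (measurable_powR p)).
  apply: heis_continuous_measurable.
  exact: (continuous_enorm2 (@component_continuous false) (@component_continuous true)).
split=> //.
pose N := \bigcup_k [set q : heis R | psi s k q != 0].
have mN : measurable N by apply: bigcupT_measurable => k; exact: psi_support_measurable.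
pose M : R := (K + K) `^ p.
apply: (@le_lt_trans _ _ (\int[heis_measure]_q (M%:E * (\1_N q)%:E))%E).
  apply: ge0_le_integral => //.
  - by apply: measurableT_comp.
  - apply/measurable_EFinP; apply: measurable_funM => //; exact: measurable_indic.
  move=> q _; rewrite abse_EFin -EFinM lee_fin ger0_norm ?powR_ge0//.
  have KK : 0 <= K + K by rewrite addr_ge0// ltW.
  rewrite indicE; have [_|qN] := boolP (q \in N).
    rewrite mulr1; apply: ge0_ler_powR; rewrite ?nnegrE ?sqrtr_ge0//; first exact: ltW.
    apply: le_trans (enorm2_le _) _ => /=.
    have /andP[f0 f1] := component_bound false q;
        have /andP[g0 g1] := component_bound true q.
    by rewrite !ger0_norm// lerD.
  have q0 k : psi s k q = 0.
    apply/eqP; apply: contraNT qN => qk; apply/mem_set; by exists k.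
  by rewrite mulr0 /sobolev_map !component_eq0// /enorm2 /= expr0n/= addr0 sqrtr0 powR0
      ?gt_eqF.
have [C0 C00 tubeC] := @heis_measure_tube R.
pose Ks : R := (1 - ratio s ^+ 2)^-1.
have Ks0 : 0 < Ks by rewrite invr_gt0; have := ratio_sqr_lt s02; lra.
have NT : N `<=` tube 0 0 (Ks + 1).
  move=> q [k _ qk]; have q3 := psi_neq0_x qk.
  have [_ [r' [_ r'01 _ h1 h2]]] := psi_neq0 qk.
  have cl i := coord_le (ratio_sqr_lt s02) (level_gt0 s) (level_ni s02) (level_step s) i r'.
  have cg i := coord_ge0 (ratio_sqr_lt s02) (level_gt0 s) (level_step s) i r'.
  have bound (x c : R) : `|x - c| < gap k -> 0 <= c -> c <= Ks -> `|x - 0| <= Ks + 1.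
    move=> + c0 cK; rewrite subr0 ltr_norml ler_norml => /andP[? ?].
    by have := gap_le1 (R := R) k => ?; apply/andP; split; lra.
  have l0 : level s 0 = 1 by rewrite /level expr0.
  have := cl false; have := cl true; rewrite l0 mulr1 -/Ks => cl1 cl2.
  by split=> //; [exact: bound h1 (cg false) cl2|exact: bound h2 (cg true) cl1].
rewrite ge0_integralZl_EFin//; last 2 first.
- by apply/measurable_EFinP; exact: measurable_indic.
- exact: powR_ge0.
rewrite integral_indic// setIT.
have K1 : 0 < Ks + 1 by rewrite ltr_wpDl// ltW.
apply: (@le_lt_trans _ _ (M%:E * (C0 * (Ks + 1) ^+ 2)%:E)%E); last exact: ltry.
apply: lee_wpmul2l; first by rewrite lee_fin powR_ge0.
apply: le_trans (hausdorff_measure_sub hdist 4 NT) _.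
exact: tubeC.
Qed.

End sobolev_map.

(** * The upper gradient and its energy *)

Section upper_gradient.
Context {R : realType}.
Variables (p alpha : R).
Hypothesis p1 : 1 <= p.
Hypothesis alpha12 : 1 < alpha < 2.

Let s : R := 2 - p * (1 - alpha^-1).

Hypothesis s02 : 0 < s < 2.

Let p0 : 0 < p. Proof. exact: lt_le_trans p1. Qed.

Let u k (q : heis R) := weight alpha k * psi s k q.

Let L k : R := weight alpha k * (15 / gap k).

Let L_ge0 k : 0 <= L k.
Proof.
apply: mulr_ge0; first by rewrite ltW// weight_gt0.
by apply: divr_ge0; [exact: ler0n|rewrite ltW// gap_gt0].
Qed.

Let uL k a b : `|u k a - u k b| <= L k * hdist a b.
Proof.
rewrite /u /L -mulrBr normrM ger0_norm ?(ltW (weight_gt0 _ _))// -mulrA.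
by rewrite ler_wpM2l ?(ltW (weight_gt0 _ _))// psi_lipschitz.
Qed.

Let coef k : R := (L k / kap k) `^ p.

Let N k : set (heis R) := [set q | u k q != 0].

Let NE k : N k = [set q | psi s k q != 0].
Proof.
apply/seteqP; split => q /=.
  by apply: contra => /eqP h; rewrite /N /u h mulr0.
by move=> h; apply: mulf_neq0 => //; rewrite gt_eqF// weight_gt0.
Qed.

(** Many supports may overlap at a point. Dividing by [kap k], whose sum is at most 1, lets one root
    dominate the sum of all active Lipschitz constants, while the p-th power remains a plain series
    of indicators. *)
Definition sobolev_gradient (q : heis R) : \bar R :=
  (weighted_indic coef N q `^ p^-1)%E.

Let coef_ge0 k : 0 <= coef k.
Proof. exact: powR_ge0. Qed.

Let mN k : measurable (N k).
Proof. by rewrite NE; exact: psi_support_measurable. Qed.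

(** The truncation rank depends on the error [e], but the bound by the line integral holds at every
    rank, so [e] may tend to 0. *)
Lemma sobolev_gradient_upper : upper_gradient (sobolev_map s alpha) sobolev_gradient.
Proof.
split.
- by move=> q; exact: poweR_ge0.
- apply: (measurableT_comp (measurable_poweR _)).
  exact: measurable_weighted_indic.
move=> gamma rg; have gcont := rectifiable_uniform rg; have [_ gfin] := rg.
apply/lee_addgt0Pr => e e0.
have [n hn] := sobolev_map_increment s alpha12 (gamma 0) (gamma 1) e0.
apply: (@le_trans _ _ ((\sum_(k < n) `|u k (gamma 0) - u k (gamma 1)|)%:E + e%:E)%E).
  by rewrite -EFinD lee_fin.
apply: leeD => //.
exact: (sum_increments_le_line_integral (@hdist_ge0 R) (@hdistxx R) (@hdist_sym R)
  (@hdist_triangle R) gcont gfin p0 L_ge0 (@kap_gt0 R) (@kap_sum R) uL).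
Qed.

(* [gap k `^ (2 - s) = gap k `^ (p - p / alpha)] turns the volume bound into the
   scale at which [weight k] was chosen. *)
Let energy_term k : coef k * gap k `^ (2 - s) <= 15 `^ p * kap k.
Proof.
have g0 := gap_gt0 (R := R) k; have k0 := kap_gt0 (R := R) k; have k1 := kap_le1 (R := R) k.
have sE : 2 - s = (1 - alpha^-1) * p by rewrite /s; ring.
have LK0 : 0 <= L k / kap k by rewrite divr_ge0// ltW.
rewrite sE powRrM /coef -powRM ?powR_ge0//.
have ga0 : 0 < gap k `^ alpha^-1 by rewrite powR_gt0.
have -> : gap k `^ (1 - alpha^-1) = gap k / gap k `^ alpha^-1.
  by rewrite powRB ?powRr1 ?(ltW g0)// (gt_eqF g0) implybT.
have -> : L k / kap k * (gap k / gap k `^ alpha^-1) =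
    15 * (kap k * ((kap k * level alpha k) / gap k `^ alpha^-1)).
  rewrite /L /weight; move: (gap k) g0 (kap k) k0 (level alpha k).
  move=> y y0 z z0 l; move: (15 : R) => c; field.
  by rewrite !gt_eqF ?powR_gt0//.
apply: (@le_trans _ _ ((15 * kap k) `^ p)).
  apply: ge0_ler_powR; rewrite ?nnegrE ?(ltW p0)//.
  - apply: mulr_ge0; first exact: ler0n.
    apply: mulr_ge0; first exact: ltW.
    apply: divr_ge0; last exact: ltW.
    by apply: mulr_ge0; [exact: ltW|rewrite ltW// level_gt0].
  - by apply: mulr_ge0; [exact: ler0n|exact: ltW].
  apply: ler_wpM2l; first exact: ler0n.
  rewrite ler_piMr ?(ltW k0)// ler_pdivrMr// mul1r.
  exact: kap_level_le.
rewrite powRM ?(ltW k0) ?ler0n//; apply: ler_wpM2l; first exact: powR_ge0.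
by apply: ge1r_powR => //; rewrite k0.
Qed.

Lemma sobolev_gradient_integrable :
  heis_measure.-integrable setT (fun q => (sobolev_gradient q `^ p)%E).
Proof.
have E0 q : (0 <= weighted_indic coef N q)%E by exact: weighted_indic_ge0.
have -> : (fun q => (sobolev_gradient q `^ p)%E) = weighted_indic coef N.
  apply/funext => q; rewrite /sobolev_gradient -poweRrM mulVf ?gt_eqF//.
  by rewrite poweRe1.
apply/integrableP; split; first exact: measurable_weighted_indic.
under eq_integral do rewrite gee0_abs//.
rewrite integral_weighted_indic//.
have [C C0 hC] := psi_support_measure s02.
apply: (@le_lt_trans _ _ (\sum_(0 <= k <oo) (C * 15 `^ p * kap k)%:E)%E).
  apply: lee_nneseries => [k _ _|k _]; first by rewrite mule_ge0// lee_fin.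
  apply: (@le_trans _ _ ((coef k)%:E * (C * gap k `^ (2 - s))%:E)%E).
    by apply: lee_wpmul2l; [rewrite lee_fin|rewrite NE; exact: hC].
  rewrite -EFinM lee_fin mulrCA -[leRHS]mulrA.
  exact: (ler_wpM2l C0 (energy_term k)).
apply: (@le_lt_trans _ _ (C * 15 `^ p)%:E); last exact: ltry.
apply: lime_le.
  apply: is_cvg_nneseries => k _ _; rewrite lee_fin mulr_ge0 ?(ltW (kap_gt0 _))//.
  by rewrite mulr_ge0 ?powR_ge0.
apply: nearW => n; rewrite sumEFin lee_fin -mulr_sumr big_mkord.
by rewrite ler_piMr ?kap_sum// mulr_ge0 ?powR_ge0.
Qed.

End upper_gradient.

(** * Dimension of the images of cosets *)

Section image_dimension.
Context {R : realType}.
Variables s alpha : R.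
Hypothesis s02 : 0 < s < 2.
Hypothesis alpha12 : 1 < alpha < 2.

Lemma sobolev_map_coset e (r : R) : 0 <= r < 1 -> dust_set s e ->
  sobolev_map s alpha (hmul e (time r, 0, 0)) =
  (coord (weight alpha) false r, coord (weight alpha) true r).
Proof.
move=> r01 Ee; have pE : (fun k => psi s k (hmul e (time r, 0, 0))) = bitR r.
  by apply/funext => k; exact: psi_coset.
by rewrite /sobolev_map /component pE.
Qed.

(** The image contains the whole planar dust with weights [weight alpha]. For [b] below [alpha] its
    coding has a [b]-Hoelder inverse, so its measure of exponent [b] is positive and [b] cannot
    enter the infimum. *)
Lemma hausdorff_dim_image e : dust_set s e ->
  (alpha%:E <= hausdorff_dim edist2 (sobolev_map s alpha @` lcoset_Vx e))%E.
Proof.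
move=> Ee; apply: le_ereal_inf_tmp => _ [b [b0 Hb] <-].
rewrite lee_fin leNgt; apply/negP => ba.
have [|C C0 hC] := @weight_growth _ _ alpha12 b; first by rewrite b0.
have a02 : 0 < alpha < 2 by case/andP: alpha12 => ? ?; apply/andP; split; lra.
pose gp := (1 - 2 * ratio alpha ^+ 2) / (1 - ratio alpha ^+ 2).
have gp0 : 0 < gp := coord_gap_gt0 (ratio_sqr_lt a02).
have : (0 < hausdorff_measure edist2 b (sobolev_map s alpha @` lcoset_Vx e))%E.
  apply: (@hausdorff_measure_holder_gt0 _ _ _ (@edist2_ge0 R) b (C / gp `^ b)
    (fun r => (coord (weight alpha) false r, coord (weight alpha) true r))) => //.
  - by rewrite divr_gt0// powR_gt0.
  - move=> _ [r r01 <-]; exists (hmul e (time r, 0, 0)).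
      by exists (time r, 0, 0) => //; exists (time r).
    by apply: sobolev_map_coset => //; move: r01; rewrite /= in_itv.
  move=> r r'; rewrite !in_itv/= => r01 r'01.
  apply: (coord_holder (ratio_sqr_lt a02) (weight_gt0 alpha) (weight_step alpha)) => //.
  by case; [exact: (normr2_le_edist2 (_, _) (_, _))|exact: (normr1_le_edist2 (_, _) (_,
      _))].
by rewrite Hb ltxx.
Qed.

End image_dimension.

Theorem theorem1p5 (R : realType) (p : R) (hp : 4 < p) (alpha : R)
    (halpha : 1 < alpha < p / (p - 2)) :
  exists (E : set (heis R)) (f : heis R -> R * R),
    [/\ compact E /\ E `<=` Vx_perp,
        continuous f /\ sobolev p f,
        (0 < hausdorff_measure edist3 (2 - p * (1 - alpha^-1)) E < +oo)%E &
        forall a, E a ->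
          (alpha%:E <= hausdorff_dim edist2 (f @` lcoset_Vx a))%E].
Proof.
have p2 : 0 < p - 2 by lra.
have [a1 ap] := andP halpha; rewrite ltr_pdivlMr// in ap.
(* If [alpha] were at least 2, then [2 * (p - 2) < p], contrary to [4 < p]. *)
have alpha12 : 1 < alpha < 2.
  rewrite a1/= ltNge; apply/negP => a2; move: ap; rewrite ltNge => /negP; apply.
  by apply: le_trans (ler_wpM2r (ltW p2) a2); lra.
have a0 : 0 < alpha by lra.
pose s := 2 - p * (1 - alpha^-1).
have s02 : 0 < s < 2.
  have ia1 : alpha^-1 < 1 by rewrite invf_lt1.
  have pia : 0 < p * (1 - alpha^-1) by rewrite mulr_gt0; lra.
  apply/andP; split; last by rewrite /s; lra.
  (* Multiplied by [alpha], positivity of [s] is the hypothesis [alpha * (p - 2) < p]. *)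
  rewrite -(pmulr_lgt0 _ a0) (_ : s * alpha = p - alpha * (p - 2)) ?subr_gt0//.
  by rewrite /s; field; rewrite gt_eqF.
exists (dust_set s), (sobolev_map s alpha); split.
- by split; [exact: dust_set_compact|exact: dust_set_Vx_perp].
- split; first exact: sobolev_map_continuous.
  split; first by apply: sobolev_map_integrable => //; lra.
  exists (sobolev_gradient p alpha); split.
    by apply: sobolev_gradient_upper => //; lra.
  by apply: sobolev_gradient_integrable => //; lra.
- by rewrite dust_set_measure_gt0 ?dust_set_measure_lt_pinfty.
- by move=> a; exact: hausdorff_dim_image.
Qed.
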